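(* Let $\Lambda$ be a finitely generated group, and let $\Lambda\curvearrowright X$ be a minimal and expansive action by homeomorphisms on a Cantor space $X$. Assume that $G$ is a totally disconnected locally compact group into which $\mathbb{A}(\Lambda,X)$ embeds as a dense subgroup. Then the action of $\mathbb{A}(\Lambda,X)$ on $X$ extends to a continuous action of $G$ on $X$.
   Context: The topological full group $\mathbb{F}(\Lambda,X)$ is the group of homeomorphisms $g$ of $X$ such that for every $x\in X$ there exist a neighbourhood $U$ of $x$ and $\gamma\in\Lambda$ with $g(y)=\gamma(y)$ for all $y\in U$. Given a non-empty clopen $U\subseteq X$ and $\gamma_1,\dots,\gamma_n\in\Lambda$ such that $\gamma_1(U),\dots,\gamma_n(U)$ are pairwise disjoint, there is an injective homomorphism $\mathrm{Sym}(n)\to\mathbb{F}(\Lambda,X)$, $\sigma\mapsto g_\sigma$, with $g_\sigma(x)=\gamma_{\sigma(i)}\gamma_i^{-1}(x)$ if $x\in\gamma_i(U)$ and $g_\sigma(x)=x$ if $x\notin\bigcup_i\gamma_i(U)$. The alternating full group $\mathbb{A}(\Lambda,X)$ is the subgroup of $\mathbb{F}(\Lambda,X)$ generated by the images of the alternating groups $\mathrm{Alt}(n)$ under all such homomorphisms. The action $\Lambda\curvearrowright X$ is expansive if there exist a compatible metric $d$ on $X$ and $\delta>0$ such that for all $x\neq y$ in $X$ there is $\gamma\in\Lambda$ with $d(\gamma(x),\gamma(y))\ge\delta$. ''Embeds as a dense subgroup'' means that there is an injective (abstract) group homomorphism $\mathbb{A}(\Lambda,X)\to G$ with dense image; the action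 ''extends'' if the given action is the composite of this homomorphism with the $G$-action. *)

(* Defs.v *)
From HB Require Import structures.
From mathcomp Require Import all_boot all_order all_algebra all_fingroup alt.
From mathcomp Require Import boolp classical_sets functions cardinality reals.
From mathcomp Require Import topology cantor.

Set Implicit Arguments.
Unset Strict Implicit.
Unset Printing Implicit Defensive.

Local Open Scope classical_set_scope.
Local Open Scope group_scope.

Section Subgroups.
Variable G : groupType.

Definition is_subgroup (H : set G) : Prop :=
  [/\ H 1, (forall x y, H x -> H y -> H (x * y)) & (forall x, H x -> H x^-1)].

Definition generated_subgroup (S : set G) : set G := smallest is_subgroup S.

Lemma is_subgroup_generated (S : set G) : is_subgroup (generated_subgroup S).
Proof.
split=> [M [[]] //|x y Hx Hy M MS|x Hx M MS].
- by have [[_ MM _] _] := MS; apply: MM; [exact: Hx|exact: Hy].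
- by have [[_ _ MV] _] := MS; apply: MV; exact: Hx.
Qed.

End Subgroups.

Definition finitely_generated (G : groupType) : Prop :=
  exists2 S : set G, finite_set S & generated_subgroup S = [set: G].

HB.mixin Record isTopologicalGroup G of monoid.Group G & Topological G := {
  mulg_continuous : continuous (fun xy : G * G => (xy.1 * xy.2)%g) ;
  invg_continuous : continuous (fun x : G => x^-1%g)
}.

#[short(type="topGroupType")]
HB.structure Definition TopologicalGroup :=
  {G of monoid.Group G & Topological G & isTopologicalGroup G}.

(* Hausdorffness is not listed: it follows from total disconnectedness, because
   the closure of the identity in a topological group is connected. *)
Definition tdlc (G : topGroupType) : Prop :=
  locally_compact [set: G] /\ totally_disconnected [set: G].

Section Homeomorphisms.
Variable X : topologicalType.

Record homeo := Homeo {
  homeo_fun :> X -> X ;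
  homeo_inv : X -> X ;
  homeo_continuous : continuous homeo_fun ;
  homeo_inv_continuous : continuous homeo_inv ;
  homeoK : cancel homeo_fun homeo_inv ;
  homeo_invK : cancel homeo_inv homeo_fun
}.

Lemma homeoP (f g : homeo) : f =1 g -> f = g.
Proof.
case: f g => [f f' cf cf' fK f'K] [g g' cg cg' gK g'K] /= fg.
have efg : f = g by apply/funext.
subst g; have efg' : f' = g'.
  by apply/funext => x; rewrite -[in LHS](g'K x) fK.
by subst g'; congr Homeo; exact: Prop_irrelevance.
Qed.

Definition homeo1 : homeo :=
  @Homeo id id (fun x => @cvg_id _ (nbhs x)) (fun x => @cvg_id _ (nbhs x))
    (fun=> erefl) (fun=> erefl).

Definition homeoV (f : homeo) : homeo :=
  Homeo (@homeo_inv_continuous f) (@homeo_continuous f)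
    (@homeo_invK f) (@homeoK f).

Definition homeoM (f g : homeo) : homeo :=
  @Homeo (f \o g) (homeo_inv g \o homeo_inv f)
    (fun x => continuous_comp (@homeo_continuous g x)
                (@homeo_continuous f (g x)))
    (fun x => continuous_comp (@homeo_inv_continuous f x)
                (@homeo_inv_continuous g (homeo_inv f x)))
    (can_comp (@homeoK f) (@homeoK g))
    (can_comp (@homeo_invK g) (@homeo_invK f)).

HB.instance Definition _ := gen_eqMixin homeo.
HB.instance Definition _ := gen_choiceMixin homeo.

Lemma homeoMA : associative homeoM.
Proof. by move=> f g h; exact: homeoP. Qed.
Lemma homeoM1l : left_id homeo1 homeoM.
Proof. by move=> f; exact: homeoP. Qed.
Lemma homeoM1r : right_id homeo1 homeoM.
Proof. by move=> f; exact: homeoP. Qed.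
Lemma homeoMVl : left_inverse homeo1 homeoV homeoM.
Proof. by move=> f; apply: homeoP => x /=; exact: homeoK. Qed.
Lemma homeoMVr : right_inverse homeo1 homeoV homeoM.
Proof. by move=> f; apply: homeoP => x /=; exact: homeo_invK. Qed.

HB.instance Definition _ :=
  isGroup.Build homeo homeoMA homeoM1l homeoM1r homeoMVl homeoMVr.

Lemma homeo1E x : (1 : homeo) x = x. Proof. by []. Qed.
Lemma homeoME (f g : homeo) x : (f * g) x = f (g x). Proof. by []. Qed.
Lemma homeoVE (f : homeo) x : f^-1 x = homeo_inv f x. Proof. by []. Qed.

End Homeomorphisms.

(* An action by homeomorphisms of a group on a space X is a homomorphism from
   the group to [homeo X]; since products in [homeo X] are composites, these are
   left actions. *)

Notation group_hom G H := (monoid.UMagmaMorphism.type G H).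

Definition minimal_action (L : groupType) (X : topologicalType)
    (act : group_hom L (homeo X)) : Prop :=
  forall x : X, dense (range (fun l : L => act l x)).

Definition is_metric (R : realType) (T : Type) (d : T -> T -> R) : Prop :=
  [/\ (forall x y, 0 <= d x y)%R,
      (forall x y, d x y = 0%R <-> x = y),
      (forall x y, d x y = d y x) &
      (forall x y z, d x z <= d x y + d y z)%R].

Definition compatible_metric (R : realType) (X : topologicalType)
    (d : X -> X -> R) : Prop :=
  is_metric d /\
  forall (x : X) (A : set X),
    nbhs x A <-> exists2 e : R, (0 < e)%R & [set y | (d x y < e)%R] `<=` A.

Definition expansive_action (R : realType) (L : groupType)
    (X : topologicalType) (act : group_hom L (homeo X)) : Prop :=
  exists (d : X -> X -> R) (delta : R),
    [/\ compatible_metric d, (0 < delta)%R &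
        forall x y : X, x <> y ->
          exists l : L, (delta <= d (act l x) (act l y))%R].

Definition homeomorphic (X Y : topologicalType) : Prop :=
  exists (f : X -> Y) (g : Y -> X),
    [/\ continuous f, continuous g, cancel f g & cancel g f].

(* [cantor_like] is not used because it also holds of the empty space. *)
Definition is_cantor_space (X : topologicalType) : Prop :=
  homeomorphic X cantor_space.

Section FullGroups.
Variables (L : groupType) (X : topologicalType).
Variable act : group_hom L (homeo X).

Definition topological_full_group : set (homeo X) :=
  [set g | forall x : X, exists l : L, \forall y \near x, g y = act l y].

(* [g] is the homeomorphism g_s given by the permutation [s] of the disjoint
   sets gamma_i(U). *)
Definition permutes_translates (n : nat) (U : set X) (gamma : 'I_n -> L)
    (s : {perm 'I_n}) (g : homeo X) : Prop :=
  (forall (i : 'I_n) (x : X), (act (gamma i) @` U) x ->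
     g x = act (gamma (s i) * (gamma i)^-1) x) /\
  (forall x : X, ~ (\bigcup_i (act (gamma i) @` U)) x -> g x = x).

Definition disjoint_translates (n : nat) (U : set X) (gamma : 'I_n -> L) :
    Prop :=
  [/\ U !=set0, clopen U & trivIset [set: 'I_n] (fun i => act (gamma i) @` U)].

Let open_act (l : L) (U : set X) : open U -> open (act l @` U).
Proof.
move=> oU; rewrite (_ : _ @` _ = homeo_inv (act l) @^-1` U).
  by apply: open_comp => // x _; exact: homeo_inv_continuous.
apply/seteqP; split=> [_ [x Ux <-]|x Ux] /=; first by rewrite homeoK.
by exists (homeo_inv (act l) x) => //; exact: homeo_invK.
Qed.

Let closed_act (l : L) (U : set X) : closed U -> closed (act l @` U).
Proof.
move=> cU; rewrite (_ : _ @` _ = homeo_inv (act l) @^-1` U).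
  by apply: preimage_closed => // x _; exact: homeo_inv_continuous.
apply/seteqP; split=> [_ [x Ux <-]|x Ux] /=; first by rewrite homeoK.
by exists (homeo_inv (act l) x) => //; exact: homeo_invK.
Qed.

Let open_outside (n : nat) (U : set X) (gamma : 'I_n -> L) :
  clopen U -> open (~` \bigcup_i (act (gamma i) @` U)).
Proof.
move=> [_ cU]; rewrite openC; apply: closed_bigcup => [|i _].
  exact: finite_finset.
exact: closed_act.
Qed.

Lemma permutes_translates_full n U (gamma : 'I_n -> L) s g :
  disjoint_translates U gamma -> permutes_translates U gamma s g ->
  topological_full_group g.
Proof.
move=> [_ coU _] [gin gout] x.
have [[i _ Uix]|xU] := pselect ((\bigcup_i (act (gamma i) @` U)) x).
  exists (gamma (s i) * (gamma i)^-1).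
  have := open_nbhs_nbhs (conj (open_act (gamma i) coU.1) Uix).
  by apply: filterS => y; exact: gin.
exists 1; have := open_nbhs_nbhs (conj (open_outside gamma coU) xU).
by apply: filterS => y /gout ->; rewrite gmulf1.
Qed.

Lemma permutes_translates_exists n U (gamma : 'I_n -> L) s :
  disjoint_translates U gamma ->
  exists! g : homeo X, permutes_translates U gamma s g.
Proof.
move=> [_ coU tU]; pose cell i := act (gamma i) @` U.
pose f (t : {perm 'I_n}) x :=
  if pselect (exists i, cell i x) is left e
  then act (gamma (t (projT1 (cid e))) * (gamma (projT1 (cid e)))^-1) x else x.
have fin t i x : cell i x -> f t x = act (gamma (t i) * (gamma i)^-1) x.
  move=> cix; rewrite /f; case: pselect => [e|[]]; last by exists i.
  case: (cid e) => j cjx /=.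
  by rewrite (tU j i)//; exists x.
have fout t x : ~ (\bigcup_i cell i) x -> f t x = x.
  by move=> ncx; rewrite /f; case: pselect => // -[i ?]; case: ncx; exists i.
have fcell (t : {perm 'I_n}) i x : cell i x -> cell (t i) (f t x).
  move=> cix; rewrite (fin t i)//; case: cix => y Uy <-.
  by exists y => //; rewrite gmulfM gmulfV /= homeoK.
have fK (t u : {perm 'I_n}) : cancel t u -> cancel (f t) (f u).
  move=> tuK x; have [[i _ cix]|ncx] := pselect ((\bigcup_i cell i) x).
    rewrite (fin u (t i)); last exact: fcell.
    by rewrite (fin t i)// -homeoME -gmulfM tuK mulgA mulgVK mulgV gmulf1.
  by rewrite (fout t) // fout.
have fcont t : continuous (f t).
  move=> x; have [[i _ cix]|ncx] := pselect ((\bigcup_i cell i) x).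
    have nx := open_nbhs_nbhs (conj (open_act (gamma i) coU.1) cix).
    rewrite /continuous_at (fin t i)//.
    apply: cvg_trans; last exact: (@homeo_continuous _ (act _) x).
    apply: near_eq_cvg; apply: filterS nx => y ciy.
    by rewrite (fin t i).
  have nx := open_nbhs_nbhs (conj (open_outside gamma coU) ncx).
  rewrite /continuous_at fout//; apply: cvg_trans; last exact: cvg_id.
  by apply: near_eq_cvg; apply: filterS nx => y ncy; rewrite fout.
exists (Homeo (fcont s) (fcont s^-1)
          (fK _ _ (permK s)) (fK _ _ (permKV s))).
split=> [|g [gin gout]]; first by split; [exact: fin|exact: fout].
apply: homeoP => x /=.
have [[i _ cix]|ncx] := pselect ((\bigcup_i cell i) x).
  by rewrite (fin s i)// (gin i).
by rewrite fout// gout.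
Qed.

Lemma is_subgroup_topological_full_group : is_subgroup topological_full_group.
Proof.
split=> [x|g h Fg Fh x|g Fg x].
- by exists 1; near=> y; rewrite gmulf1.
- have [l hl] := Fh x; have [k gk] := Fg (h x).
  exists (k * l).
  have gk' : \forall y \near x, g (h y) = act k (h y).
    by have := @homeo_continuous _ h x _ gk.
  near=> y; rewrite gmulfM !homeoME -(near hl y)//.
  exact: (near gk' y).
- have [l gl] := Fg (homeo_inv g x); exists l^-1.
  have gl' : \forall y \near x, g (homeo_inv g y) = act l (homeo_inv g y).
    by have := @homeo_inv_continuous _ g x _ gl.
  apply: filterS gl' => y; rewrite homeo_invK => gy.
  by rewrite gmulfV [in RHS]gy !homeoVE homeoK.
Unshelve. all: by end_near. Qed.

Definition alternating_elements : set (homeo X) :=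
  [set g | exists (n : nat) (U : set X) (gamma : 'I_n -> L) (s : {perm 'I_n}),
     [/\ disjoint_translates U gamma, s \in 'Alt_('I_n) &
         permutes_translates U gamma s g]].

Definition alternating_full_group : set (homeo X) :=
  generated_subgroup alternating_elements.

Definition alternating_full_groupType : Type := alternating_full_group.

Lemma alternating_full_group_sub :
  alternating_full_group `<=` topological_full_group.
Proof.
apply: smallest_sub; first exact: is_subgroup_topological_full_group.
move=> g [n [U [gamma [s [dU _ gP]]]]].
exact: permutes_translates_full dU gP.
Qed.

HB.instance Definition _ := SubType.on alternating_full_groupType.
HB.instance Definition _ := Choice.on alternating_full_groupType.

Lemma alternating_full_group_closed :
  group_closed [in alternating_full_group].
Proof.
have [A1 AM AV] := is_subgroup_generated alternating_elements.
split; first by rewrite inE.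
by move=> x y; rewrite !inE => Ax Ay; apply: AM => //; exact: AV.
Qed.

HB.instance Definition _ :=
  SubChoice_isSubGroup.Build _ _ alternating_full_groupType
    alternating_full_group_closed.

End FullGroups.

(* Main.v *)
Require Import Defs.
From HB Require Import structures.
From mathcomp Require Import all_boot all_order all_algebra all_fingroup alt.
From mathcomp Require Import boolp classical_sets functions cardinality reals.
From mathcomp Require Import topology cantor.

(** Why the theorem holds.  Let A be the alternating full group, embedded in G,
    and call an element of A small when its image in G is close to 1.

    Everything reduces to a continuity statement: each clopen subset of X is
    preserved by all sufficiently small elements of A ([clopen_stable]).  Indeed,
    if elements of A tend to g in G, quotients of two of them are small, so the
    images of a point eventually stay in any clopen set that they visit; the
    pointwise limits exist, depend continuously on the pair, and define the
    action of G ([extension_action]).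

    By compactness it is enough to separate two points x <> y: some
    neighbourhood of x is carried by no small element into some neighbourhood of
    y ([points_separated]).  Failure of separation is inherited by limits of
    pairs and by the images of pairs under A, and A moves any pair of distinct
    points close to any other pair.  Hence one bad pair forces the small elements
    to carry points of any open set into any other
    ([not_separated_transitive]).  This is contradicted as follows.  Local
    compactness provides a compact open subgroup K of G, a coset tK and a
    non-empty open set V such that no element of A in tK is the identity on a
    non-empty open subset of V ([moving_coset]).  Take a in A with image in tK,
    and a 3-cycle g such that g^-1 agrees with a^-1 near a point z of V and g is
    trivial on some open set Y.  A small h that carries a point of Y close to
    a^-1 z makes h' = h g h^-1 g^-1 small and equal to a^-1 on an open part of
    V; then a h' is trivial there although it still lies in tK.

    The coset tK comes from a finite set S of 3-cycles whose generated subgroup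
    B is rich ([finite_cycle_system]).  As S is finite, K S K is covered by
    finitely many cosets of K.  If no tK as above existed, one could shrink an
    open set W until each of these cosets contains an element of A that is
    trivial on W.  With F the group of elements of A trivial on W, this gives
    B <= F K ([generated_factors]).  Elements of F commute with elements
    supported in W, so on the latter conjugation by B reduces to conjugation by
    K ([conj_factor]).  Therefore, modulo any neighbourhood of 1 that is a
    subgroup normalised by K, an element of B supported in W has only finitely
    many conjugates by elements of B supported in W.  But W contains arbitrarily
    many disjoint translates of small clopen sets; the pigeonhole principle and
    commutators push a fixed non-trivial 3-cycle into every such subgroup
    ([absorb]), which contradicts that G is Hausdorff.

    The richness of B is the one place where finite generation of the acting
    group and expansivity are used, and it is a form of the theorem of
    Nekrashevych that A is finitely generated.  Expansivity gives finitely many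
    clopen sets whose translates generate all clopen sets.  Taking commutators
    of 3-cycles intersects the sets that they permute
    ([cyc3_commutator]), and finitely many auxiliary 3-cycles transport
    these sets along the generators, so B contains 3-cycles on arbitrarily
    small clopen sets ([gated_clopen]) and moves their translates along
    all orbits ([token_move]). *)

Set Implicit Arguments.
Unset Strict Implicit.
Unset Printing Implicit Defensive.
Local Open Scope classical_set_scope.
Local Open Scope group_scope.

(** * Compactness and clopen sets *)

Definition clopen_base (X : topologicalType) : Prop :=
  forall (x : X) (U : set X), nbhs x U ->
    exists V : set X, [/\ clopen V, V x & V `<=` U].

Definition cantor_axioms (X : topologicalType) : Prop :=
  [/\ compact [set: X], hausdorff_space X, clopen_base X &
      forall x : X, ~ open [set x]].

Lemma clopen_setD (X : topologicalType) (U V : set X) :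
  clopen U -> clopen V -> clopen (U `\` V).
Proof.
by move=> cU cV; rewrite setDE; apply: clopenI => //; exact: clopenC.
Qed.

Lemma cantor_space_axioms (X : topologicalType) :
  is_cantor_space X -> cantor_axioms X.
Proof.
move=> [f [g [cf cg fK gK]]].
have [pC cC hC zC] := cantor_like_cantor_space.
have hX : hausdorff_space X.
  move=> x y xy; apply: (can_inj fK); apply: hC => A B nA nB.
  have [z [Az Bz]] := xy _ _ (cf x A nA) (cf y B nB).
  by exists (f z).
have cX : compact [set: X].
  have -> : [set: X] = g @` [set: cantor_space].
    by apply/seteqP; split=> // x _; exists (f x).
  apply: continuous_compact => //; apply: continuous_subspaceT; exact: cg.
have zX : zero_dimensional X.
  move=> x y xy; have /zC[U [[oU cU] Ux Uy]] : f x != f y.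
    by apply: contra_neq xy; exact: (can_inj fK).
  exists (f @^-1` U); split=> //; split.
    by apply: open_comp => // z _; exact: cf.
  by apply: preimage_closed => // z _; exact: cf.
split=> //.
  move=> x U nU.
  have [V [Vx cV] VU] := zero_dimensional_cvg hX zX cX nU.
  by exists V.
move=> x ox; have /perfectTP/(_ (f x)) := pC; apply.
have -> : [set f x] = g @^-1` [set x].
  by apply/seteqP; split=> [_ ->|y /= <-] //=; rewrite ?fK ?gK.
by apply: open_comp => // z _; exact: cg.
Qed.

(** Compactness as an induction principle.  If [P K] failed, the sets
    whose complement in [K] satisfies [P] would form a proper filter, and no
    point of [K] could be a cluster point of it. *)
Lemma compact_ind (T : topologicalType) (P : set T -> Prop) (K : set T) :
  P set0 ->
  (forall A B, A `<=` B -> P B -> P A) ->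
  (forall A B, P A -> P B -> P (A `|` B)) ->
  compact K -> (forall x, K x -> exists2 V, nbhs x V & P V) ->
  P K.
Proof.
move=> P0 Psub PU cK Kloc; apply: contrapT => nPK.
pose F := [set A | P (K `\` A)].
have FF : ProperFilter F.
  split; first by rewrite /F /= setD0.
  split.
  - by rewrite /F /= setDT.
  - by move=> A B FA FB; rewrite /F /= setDIr; exact: PU.
  - by move=> A B AB; rewrite /F /=; apply: Psub; exact: setDS.
have [|x [Kx Fx]] := cK F FF; first by rewrite /F /= setDv.
have [V nV PV] := Kloc x Kx.
have [|z [nVz Vz]] := Fx (~` V) V _ nV; last exact: nVz.
by rewrite /F /= setDE setCK; apply: Psub PV; exact: subIsetr.
Qed.

Section Covers.
Variable X : topologicalType.

(** Induction over a cover by members of an algebra of sets: the cover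
    is made disjoint one member at a time, inside the algebra, so that [P] need
    only be stable under disjoint unions. *)
Lemma algebra_cover_ind (Alg P : set X -> Prop) (s : set (set X)) (D : set X) :
  (forall U V, Alg U -> Alg V -> Alg (U `&` V)) ->
  (forall U V, Alg U -> Alg V -> Alg (U `\` V)) ->
  P set0 ->
  (forall U V, Alg U -> Alg V -> U `&` V = set0 -> P U -> P V ->
     P (U `|` V)) ->
  finite_set s ->
  (forall Z, s Z -> Alg Z /\ forall U, Alg U -> U `<=` Z -> P U) ->
  Alg D -> D `<=` \bigcup_(Z in s) Z -> P D.
Proof.
move=> AI AD P0 PU /finite_seqP[l ->].
elim: l D => [|Z l IH] D sP aD Ds.
  suff -> : D = set0 by [].
  by rewrite -subset0 => x /Ds [].
have [aZ PZ] := sP Z (mem_head Z l).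
rewrite -(setUIDK D Z); apply: PU; rewrite ?setDE.
- exact: AI.
- by rewrite -setDE; exact: AD.
- by rewrite setIACA setICr setI0.
- by apply: PZ; [exact: AI | exact: subIsetr].
- apply: IH.
  + by move=> W lW; apply: sP; rewrite /= inE (lW : W \in l) orbT.
  + by rewrite -setDE; exact: AD.
  + move=> x [/Ds[W /=]]; rewrite inE => /predU1P[->//|lW Wx _].
    by exists W.
Qed.

Hypothesis cX : compact [set: X].

Lemma finite_clopen_cover (T : Type) (R : set X -> T -> Prop) (Y : set X) :
  closed Y ->
  (forall x, Y x -> exists (V : set X) (t : T), [/\ clopen V, V x & R V t]) ->
  exists s : set (set X * T), [/\ finite_set s,
    (forall p, s p -> clopen p.1 /\ R p.1 p.2) &
    Y `<=` \bigcup_(p in s) p.1].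
Proof.
move=> clY.
pose P A := exists s : set (set X * T), [/\ finite_set s,
  (forall p, s p -> clopen p.1 /\ R p.1 p.2) & A `<=` \bigcup_(p in s) p.1].
move=> YR; apply: (@compact_ind X P).
- by exists set0; split.
- by move=> A B AB [s [fs sP Bs]]; exists s; split=> //; exact: subset_trans Bs.
- move=> A B [s [fs sP As]] [t [ft tP Bt]]; exists (s `|` t); split.
  + by rewrite finite_setU.
  + by move=> p [/sP|/tP].
  + by rewrite bigcup_setU; exact: setUSS.
- by apply: (subclosed_compact clY cX).

- move=> x /YR[V [t [cV Vx VR]]]; exists V.
    by apply: open_nbhs_nbhs; split=> //; exact: cV.1.
  exists [set (V, t)]; split=> [|_ -> //|]; first exact: finite_set1.
  by rewrite bigcup_set1.
Qed.

(** A property of clopen sets that is additive on disjoint unions and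
    holds for all small clopen sets holds for all of them. *)
Lemma clopen_ind (P : set X -> Prop) (Y : set X) :
  P set0 ->
  (forall U V, clopen U -> clopen V -> U `&` V = set0 -> P U -> P V ->
     P (U `|` V)) ->
  clopen Y ->
  (forall x, Y x -> exists V, [/\ clopen V, V x &
     forall U, clopen U -> U `<=` V -> P U]) ->
  P Y.
Proof.
move=> P0 PU clY Yloc.
have [|s [fs sP Ys]] := @finite_clopen_cover unit
    (fun V _ => forall U, clopen U -> U `<=` V -> P U) Y clY.2.
  by move=> x /Yloc[V [cV Vx VP]]; exists V, tt.
apply: (@algebra_cover_ind clopen P (fst @` s)) => //.
- by move=> U V cU cV; exact: clopenI.
- exact: clopen_setD.
- exact: finite_image.
- by move=> _ [p /sP[? ?] <-].
- by move=> x /Ys[p sp px]; exists p.1 => //; exists p.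
Qed.

End Covers.

(** * Homeomorphisms permuting three translates of a clopen set *)

Section Rotations.
Variables (L : groupType) (X : topologicalType).
Variable act : group_hom L (homeo X).
Implicit Types (a b c d e f l : L) (C D V : set X) (x y z : X).

Lemma act_mul a b x : act (a * b) x = act a (act b x).
Proof. by rewrite gmulfM. Qed.

Lemma act_one x : act 1 x = x.
Proof. by rewrite gmulf1. Qed.

Lemma act_invl a : cancel (act a) (act a^-1).
Proof. by move=> x; rewrite -act_mul mulVg act_one. Qed.

Lemma act_invr a : cancel (act a^-1) (act a).
Proof. by move=> x; rewrite -act_mul mulgV act_one. Qed.

Lemma act_injective a : injective (act a).
Proof. exact: can_inj (act_invl a). Qed.

Lemma homeo_inj (g : homeo X) : injective g.
Proof. exact: can_inj (@homeoK _ g). Qed.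

Definition apart (p q : L * set X) : Prop :=
  forall y z, p.2 y -> q.2 z -> act p.1 y <> act q.1 z.

Fixpoint floors_disjoint (s : seq (L * set X)) : Prop :=
  if s is p :: s' then
    foldr (fun q P => apart p q /\ P) True s' /\ floors_disjoint s'
  else True.

Definition floors3 C a b c : Prop :=
  floors_disjoint [:: (a, C); (b, C); (c, C)].

Definition cyc3_spec C a b c (g : homeo X) : Prop :=
  [/\ forall y, C y -> g (act a y) = act b y,
      forall y, C y -> g (act b y) = act c y,
      forall y, C y -> g (act c y) = act a y &
      forall x, (forall y, C y -> act a y <> x) ->
        (forall y, C y -> act b y <> x) -> (forall y, C y -> act c y <> x) ->
        g x = x].

(** The homeomorphism that carries aC to bC, bC to cC and cC back to aC,
    through the group elements themselves; it is made total by the default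
    value 1. *)
Definition cyc3 C a b c : homeo X := xget 1 [set g | cyc3_spec C a b c g].

Lemma floors_pick C a x :
  (exists2 y, C y & x = act a y) \/ (forall y, C y -> act a y <> x).
Proof.
have [[y Cy ->]|nx] := pselect (exists2 y, C y & x = act a y).
  by left; exists y.
by right=> y Cy yx; apply: nx; exists y.
Qed.

Lemma cyc3_spec_unique C a b c (g h : homeo X) :
  cyc3_spec C a b c g -> cyc3_spec C a b c h -> g = h.
Proof.
move=> [ga gb gc gx] [ha hb hc hx]; apply: homeoP => x.
have [[y Cy ->]|na] := floors_pick C a x; first by rewrite ga ?ha.
have [[y Cy ->]|nb] := floors_pick C b x; first by rewrite gb ?hb.
have [[y Cy ->]|nc] := floors_pick C c x; first by rewrite gc ?hc.
by rewrite gx ?hx.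
Qed.

Lemma cyc3_exists C a b c : clopen C -> floors3 C a b c ->
  exists g, cyc3_spec C a b c g /\ alternating_full_group act g.
Proof.
move=> cC [[ab [ac _]] [[bc _] _]].
have [C0|C0] := eqVneq C set0.
  exists 1; split; first by split=> // y; rewrite C0.
  by have [] := is_subgroup_generated (alternating_elements act).
pose gamma (i : 'I_3) := nth 1 [:: a; b; c] i.
pose i0 : 'I_3 := inord 0; pose i1 : 'I_3 := inord 1.
pose i2 : 'I_3 := inord 2.
have i01 : i0 != i1 by rewrite -val_eqE /= !inordK.
have i02 : i0 != i2 by rewrite -val_eqE /= !inordK.
have i12 : i1 != i2 by rewrite -val_eqE /= !inordK.
pose s : {perm 'I_3} := tperm i0 i1 * tperm i0 i2.
have s0 : s i0 = i1 by rewrite permM tpermL tpermD // eq_sym.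
have s1 : s i1 = i2 by rewrite permM tpermR tpermL.
have s2 : s i2 = i0 by rewrite permM [tperm i0 i1 i2]tpermD // tpermR.
have g0 : gamma i0 = a by rewrite /gamma inordK.
have g1 : gamma i1 = b by rewrite /gamma inordK.
have g2 : gamma i2 = c by rewrite /gamma inordK.
have all3 (i : 'I_3) : [\/ i = i0, i = i1 | i = i2].
  case: i => [[|[|[|//]]] ?]; [apply: Or31|apply: Or32|apply: Or33];
  by apply: val_inj; rewrite /= inordK.
have dC : disjoint_translates act C gamma.
  split=> //; first exact/set0P.
  move=> i j _ _ [x [[y Cy <-] [z Cz]]].
  by have [->|->|->] := all3 i; have [->|->|->] := all3 j;
    rewrite ?g0 ?g1 ?g2 // => e; exfalso;
    (have := e; exact: ab) || (have := e; exact: ac) ||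
    (have := e; exact: bc) || (have := esym e; exact: ab) ||
    (have := esym e; exact: ac) || (have := esym e; exact: bc).
have [g [gP _]] := permutes_translates_exists s dC.
exists g; split.
  have [gin gout] := gP.
  have gi i y : C y -> g (act (gamma i) y) = act (gamma (s i)) y.
    by move=> Cy; rewrite (gin i) ?act_mul ?act_invl //; exists y.
  split=> [y|y|y|x na nb nc].
  - by move/(gi i0); rewrite s0 g0 g1.
  - by move/(gi i1); rewrite s1 g1 g2.
  - by move/(gi i2); rewrite s2 g2 g0.
  - apply: gout => -[i _ [y Cy]].
    have [->|->|->] := all3 i; rewrite ?g0 ?g1 ?g2.
    + exact: na.
    + exact: nb.
    + exact: nc.
apply: sub_gen_smallest; exists 3, C, gamma, s; split=> //.
by rewrite Alt_even odd_permM !odd_tperm i01 i02.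
Qed.

Lemma cyc3P C a b c : clopen C -> floors3 C a b c ->
  cyc3_spec C a b c (cyc3 C a b c).
Proof.
move=> cC dC; have [g [gP _]] := cyc3_exists cC dC.
by apply: (xgetPex 1); exists g.
Qed.

Lemma cyc3_alternating C a b c : clopen C -> floors3 C a b c ->
  alternating_full_group act (cyc3 C a b c).
Proof.
move=> cC dC; have [g [gP Ag]] := cyc3_exists cC dC.
by rewrite (cyc3_spec_unique (cyc3P cC dC) gP).
Qed.


Ltac memb := solve [assumption | split; assumption | left; assumption
  | right; assumption
  | match goal with H : forall z, @?P z -> ?D z |- ?D ?y =>
      apply: H; assumption end
  | match goal with H : ?C `<=` ?D |- ?D ?y => apply: H; assumption end ].
Ltac off_support :=
  let z := fresh "z" in let Cz := fresh "Cz" in let e := fresh "e" in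
  move=> z Cz e; exfalso;
  repeat match goal with H : (_ `&` _) z |- _ => case: H => ? ?
                    | H : (_ `\` _) z |- _ => case: H => ? ? end;
  solve
  [ match goal with
    | H : apart _ _ |- _ =>
      solve [ refine (H z _ _ _ e); simpl; memb
            | refine (H _ z _ _ (esym e)); simpl; memb ]
    | H : forall y, @?P y -> @?N y |- _ =>
      solve [ refine (H z _ e); memb ]
    end
  | move/act_injective in e; subst z; contradiction ].
Ltac cyc3_step :=
  match goal with
  | H : forall y, @?P y -> homeo_fun (cyc3 _ _ _ _) (@?Q y) = @?S y |- _ =>
    rewrite H; [|memb]
  | H : forall x, @?P x -> @?Q x -> @?S x -> homeo_fun (cyc3 _ _ _ _) x = x
    |- context [homeo_fun (cyc3 _ _ _ _) ?t] =>
    lazymatch t with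
    | context [cyc3 _ _ _ _] => fail
    | _ => rewrite (H t); [|off_support|off_support|off_support]
    end
  end.
Ltac cyc3_eval := rewrite ?homeoME; repeat cyc3_step; try reflexivity.

Lemma floors3_rev C a b c : floors3 C a b c -> floors3 C a c b.
Proof.
move=> [[ab [ac _]] [[bc _] _]]; split; split=> //.
by split=> // y z /= Cy Cz e; apply: (bc z y).
Qed.

Lemma floors3_cycle C a b c : floors3 C a b c -> floors3 C b c a.
Proof.
move=> [[ab [ac _]] [[bc _] _]]; split; split=> //; try split=> //.
  by move=> y z /= Cy Cz e; apply: (ab z y).
by move=> y z /= Cy Cz e; apply: (ac z y).
Qed.

Lemma cyc3_cycle C a b c : clopen C -> floors3 C a b c ->
  cyc3 C a b c = cyc3 C b c a.
Proof.
move=> cC dC; apply: (cyc3_spec_unique (cyc3P cC dC)).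
have [ra rb rc rx] := cyc3P cC (floors3_cycle dC).
by split=> // x na nb nc; exact: rx.
Qed.

Lemma cyc3_inv C a b c : clopen C -> floors3 C a b c ->
  (cyc3 C a b c)^-1 = cyc3 C a c b.
Proof.
move=> cC dC; have [ra rb rc rx] := cyc3P cC dC.
have [sa sb sc sx] := cyc3P cC (floors3_rev dC).
apply: mulg1_eq; apply: homeoP => x; rewrite homeo1E homeoME.
move: dC => [[ab [ac _]] [[bc _] _]].
have [[y Cy ->]|na] := floors_pick C a x; first by cyc3_eval.
have [[y Cy ->]|nb] := floors_pick C b x; first by cyc3_eval.
have [[y Cy ->]|nc] := floors_pick C c x; first by cyc3_eval.
by cyc3_eval.
Qed.

(** In the alternating group on the letters a, b, c, d this is
    (a c d)(a b c) = (a b d). *)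
Lemma cyc3_prod C a b c d : clopen C ->
  floors_disjoint [:: (a, C); (b, C); (c, C); (d, C)] ->
  cyc3 C a c d * cyc3 C a b c = cyc3 C a b d.
Proof.
move=> cC [[ab [ac [ad _]]] [[bc [bd _]] [[cd _] _]]].
have [ra rb rc rx] : cyc3_spec C a b c (cyc3 C a b c) by exact: cyc3P.
have [sa sb sc sx] : cyc3_spec C a c d (cyc3 C a c d) by exact: cyc3P.
have [ta tb tc tx] : cyc3_spec C a b d (cyc3 C a b d) by exact: cyc3P.
apply: homeoP => x.
have [[y Cy ->]|na] := floors_pick C a x; first by cyc3_eval.
have [[y Cy ->]|nb] := floors_pick C b x; first by cyc3_eval.
have [[y Cy ->]|nc] := floors_pick C c x; first by cyc3_eval.
have [[y Cy ->]|nd] := floors_pick C d x; first by cyc3_eval.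
by cyc3_eval.
Qed.


Lemma apart_sub a b C C' D D' :
  apart (a, C) (b, D) -> C' `<=` C -> D' `<=` D -> apart (a, C') (b, D').
Proof. by move=> ab CC DD y z /CC Cy /DD Dz; exact: ab. Qed.

Lemma apart_sym a b C D : apart (a, C) (b, D) -> apart (b, D) (a, C).
Proof. by move=> ab y z Dy Cz /esym; exact: ab. Qed.

(** The main tool for shrinking supports.  The two cycles share only
    the letter c, so outside of the intersection of C and D they commute,
    whereas over the intersection one computes in an alternating group on five
    letters. *)
Lemma cyc3_commutator C D a b c d e : clopen C -> clopen D ->
  floors_disjoint [:: (a, C); (b, C); (c, C `|` D); (d, D); (e, D)] ->
  cyc3 C a b c * cyc3 D c d e * (cyc3 C a b c)^-1 * (cyc3 D c d e)^-1
    = cyc3 (C `&` D) a d c.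
Proof.
move=> cC cD
  [[ab [ac [ad [ae _]]]] [[bc [bd [be _]]] [[cd [ce _]] [[de _] _]]]].
have [ra rb rc rx] : cyc3_spec C a b c (cyc3 C a b c).
  apply: cyc3P => //; do ?split => //.
    by apply: (apart_sub ac) => // z; left.
  by apply: (apart_sub bc) => // z; left.
have [sa sb sc sx] : cyc3_spec D c d e (cyc3 D c d e).
  apply: cyc3P => //; do ?split => //.
    by apply: (apart_sub cd) => // z; right.
  by apply: (apart_sub ce) => // z; right.
have [ta tb tc tx] : cyc3_spec (C `&` D) a d c (cyc3 (C `&` D) a d c).
  apply: cyc3P; first exact: clopenI.
  split; [split; [|split=> //]|split; [split=> //|split=> //]].
  - by apply: (apart_sub ad) => z [].
  - by apply: (apart_sub ac) => z [] //; left.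
  - by apply/apart_sym; apply: (apart_sub cd) => z [] //; left.
rewrite -!mulgA -invgM; apply/eqP; rewrite mulgA divg_eq; apply/eqP.
apply: homeoP => x.
have [[y Cy ->]|na] := floors_pick C a x.
  by have [Dy|Dy] := pselect (D y); cyc3_eval.
have [[y Cy ->]|nb] := floors_pick C b x.
  by have [Dy|Dy] := pselect (D y); cyc3_eval.
have [[y Cy ->]|nc] := floors_pick C c x.
  by have [Dy|Dy] := pselect (D y); cyc3_eval.
have [[y Dy xE]|nd] := floors_pick D c x.
  have Cy : ~ C y by move=> Cy; exact: (nc y Cy (esym xE)).
  by rewrite xE; cyc3_eval.
have [[y Dy ->]|nd'] := floors_pick D d x.
  by have [Cy|Cy] := pselect (C y); cyc3_eval.
have [[y Dy ->]|ne] := floors_pick D e x.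
  by have [Cy|Cy] := pselect (C y); cyc3_eval.
by cyc3_eval.
Qed.


(** A way to cut a cycle down to a smaller base D: the cycle over D
    belongs to the normal closure of any cycle over D that shares two of its
    letters. *)
Lemma cyc3_split C D a b c d : clopen C -> clopen D -> D `<=` C ->
  floors_disjoint [:: (a, C); (b, C); (c, C); (d, D)] ->
  cyc3 D a d c * cyc3 C a b c * cyc3 D a d c = cyc3 D a b c * cyc3 C a b c.
Proof.
move=> cC cD DC [[ab [ac [ad _]]] [[bc [bd _]] [[cd _] _]]].
have [ra rb rc rx] : cyc3_spec C a b c (cyc3 C a b c) by exact: cyc3P.
have [sa sb sc sx] : cyc3_spec D a d c (cyc3 D a d c).
  apply: cyc3P => //; do ?split => //; first by apply: (apart_sub ad).
    exact: (apart_sub ac).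
  by apply/apart_sym; apply: (apart_sub cd).
have [ta tb tc tx] : cyc3_spec D a b c (cyc3 D a b c).
  apply: cyc3P => //; do ?split => //; first by apply: (apart_sub ab).
    exact: (apart_sub ac).
  exact: (apart_sub bc).
apply: homeoP => x.
have [[y Cy ->]|na] := floors_pick C a x.
  by have [Dy|Dy] := pselect (D y); cyc3_eval.
have [[y Cy ->]|nb] := floors_pick C b x.
  by have [Dy|Dy] := pselect (D y); cyc3_eval.
have [[y Cy ->]|nc] := floors_pick C c x.
  by have [Dy|Dy] := pselect (D y); cyc3_eval.
have [[y Dy ->]|nd] := floors_pick D d x; last by cyc3_eval.
by have Cy := DC y Dy; cyc3_eval.
Qed.

Lemma floors3_sub C D a b c : D `<=` C -> floors3 C a b c -> floors3 D a b c.
Proof.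
move=> DC [[ab [ac _]] [[bc _] _]].
by do ?split => //; [apply: (apart_sub ab)|apply: (apart_sub ac)
  |apply: (apart_sub bc)].
Qed.

Lemma cyc3_setU C D a b c : clopen C -> clopen D -> C `&` D = set0 ->
  floors3 (C `|` D) a b c ->
  cyc3 (C `|` D) a b c = cyc3 C a b c * cyc3 D a b c.
Proof.
move=> cC cD CD f3.
have [ta tb tc tx] := cyc3P (clopenU cC cD) f3.
have [ra rb rc rx] : cyc3_spec C a b c (cyc3 C a b c).
  by apply: cyc3P => //; apply: floors3_sub f3; left.
have [sa sb sc sx] : cyc3_spec D a b c (cyc3 D a b c).
  by apply: cyc3P => //; apply: floors3_sub f3; right.
move: f3 => [[ab [ac _]] [[bc _] _]].
have nCD y : C y -> ~ D y by move=> Cy Dy; have : set0 y by rewrite -CD.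
apply: homeoP => x.
have [[y [Cy|Dy] ->]|na] := floors_pick (C `|` D) a x.
- by have Dy := nCD y Cy; cyc3_eval.
- by have Cy : ~ C y by [move=> /nCD]; cyc3_eval.
have [[y [Cy|Dy] ->]|nb] := floors_pick (C `|` D) b x.
- by have Dy := nCD y Cy; cyc3_eval.
- by have Cy : ~ C y by [move=> /nCD]; cyc3_eval.
have [[y [Cy|Dy] ->]|nc] := floors_pick (C `|` D) c x.
- by have Dy := nCD y Cy; cyc3_eval.
- by have Cy : ~ C y by [move=> /nCD]; cyc3_eval.
by cyc3_eval.
Qed.

Lemma cyc3_set0 a b c : cyc3 set0 a b c = 1.
Proof.
have f3 : floors3 set0 a b c by do ?split.
have rP : cyc3_spec set0 a b c (cyc3 set0 a b c).
  by apply: cyc3P => //; exact: clopen0.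
by apply: (cyc3_spec_unique rP).
Qed.

(** The image of [C] under [act l]. *)
Definition translate l C : set X := [set x | C (act l^-1 x)].

Lemma translateE l C y : translate l C (act l y) = C y.
Proof. by rewrite /translate /= act_invl. Qed.

Lemma translate_clopen l C : clopen C -> clopen (translate l C).
Proof.
move=> [oC cC]; split.
  by apply: open_comp => // x _; exact: homeo_continuous.
by apply: preimage_closed => // x _; exact: homeo_continuous.
Qed.

Lemma floors3_translate l C a b c :
  floors3 (translate l C) a b c <-> floors3 C (a * l) (b * l) (c * l).
Proof.
have E p q : apart (p, translate l C) (q, translate l C) <->
    apart (p * l, C) (q * l, C).
  split=> pq y z /= Cy Cz.
    by rewrite !act_mul; apply: pq; rewrite /= translateE.
  have := pq _ _ Cy Cz.
  by rewrite /= !act_mul !act_invr.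
by split=> -[[/E ? [/E ? _]] [[/E ? _] _]].
Qed.

Lemma cyc3_translate l C a b c : clopen C ->
  floors3 C (a * l) (b * l) (c * l) ->
  cyc3 (translate l C) a b c = cyc3 C (a * l) (b * l) (c * l).
Proof.
move=> cC f3; have [ra rb rc rx] := cyc3P cC f3.
apply: (cyc3_spec_unique (cyc3P (translate_clopen l cC) _)).
  exact/floors3_translate.
split=> [y Cy|y Cy|y Cy|x na nb nc].
- by have := ra _ Cy; rewrite !act_mul act_invr.
- by have := rb _ Cy; rewrite !act_mul act_invr.
- by have := rc _ Cy; rewrite !act_mul act_invr.
by apply: rx => y Cy; rewrite act_mul;
  [apply: na|apply: nb|apply: nc]; rewrite translateE.
Qed.

End Rotations.

(** * Towers of disjoint translates *)

Lemma fresh_mem (T : eqType) (n : nat) (F s : seq T) :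
  uniq F -> (n <= size F)%N -> (size s < n)%N ->
  exists2 d, d \in F & d \notin s.
Proof.
move=> uF nF sn; have sF := leq_trans sn nF; apply: contrapT => nd.
suff /(uniq_leq_size uF) : {subset F <= s} by rewrite leqNgt sF.
by move=> d dF; apply: contrapT => /negP ds; apply: nd; exists d.
Qed.

Lemma uniq_map_inj (T U : eqType) (f : T -> U) (s : seq T) :
  uniq [seq f i | i <- s] -> {in s &, injective f}.
Proof.
elim: s => //= t s IH /andP[ts us] a b; rewrite !inE.
move=> /predU1P[->|sa] /predU1P[->|sb] // e; last exact: IH.
  by move: ts; rewrite e map_f.
by move: ts; rewrite -e map_f.
Qed.

Section Towers.
Variables (L : groupType) (X : topologicalType).
Variable act : group_hom L (homeo X).
Implicit Types (a b c d e f l : L) (C D V : set X) (x y z : X) (F : seq L).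

Definition floors_apart V F : Prop :=
  forall a b, a \in F -> b \in F -> a != b -> apart act (a, V) (b, V).

Lemma floors_apart_sub C V F : C `<=` V -> floors_apart V F -> floors_apart C F.
Proof. by move=> CV dV a b aF bF ab; apply: (apart_sub (dV a b aF bF ab)). Qed.

Lemma floors_apart_floors3 C F a b c : floors_apart C F -> uniq [:: a; b; c] ->
  a \in F -> b \in F -> c \in F -> floors3 act C a b c.
Proof.
move=> dC; rewrite /= !inE !negb_or => /andP[/andP[ab ac] /andP[bc _]] aF bF cF.
by do ?split => //; exact: dC.
Qed.

Lemma floors_apart_inj V F x : floors_apart V F -> V x ->
  {in F &, injective (fun f => act f x)}.
Proof.
move=> dV Vx f g fF gF fg; apply: contrapT => /eqP fg'.
exact: (dV f g fF gF fg' x x Vx Vx fg).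
Qed.

Variable B : set (homeo X).
Hypothesis sB : is_subgroup B.

Let B1 : B 1. Proof. by have [] := sB. Qed.
Let BM g h : B g -> B h -> B (g * h).
Proof. by have [_ BM _] := sB; exact: BM. Qed.
Let BV g : B g -> B g^-1.
Proof. by have [_ _ BV] := sB; exact: BV. Qed.

Definition cycles_in C F : Prop := forall a b c, uniq [:: a; b; c] ->
  a \in F -> b \in F -> c \in F -> B (cyc3 act C a b c).

(** [cyc3_commutator] when all letters belong to one tower, so that
    disjointness is automatic. *)
Lemma cycles_in_commutator V F C D a b c d e :
  clopen C -> clopen D -> C `<=` V -> D `<=` V -> floors_apart V F ->
  uniq [:: a; b; c; d; e] -> {subset [:: a; b; c; d; e] <= F} ->
  B (cyc3 act C a b c) -> B (cyc3 act D c d e) ->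
  B (cyc3 act (C `&` D) a d c).
Proof.
move=> cC cD CV DV dV + sF BC BD.
have [aF bF cF dF eF] : [/\ a \in F, b \in F, c \in F, d \in F & e \in F].
  by split; apply: sF; rewrite !inE eqxx ?orbT.
rewrite /= !inE !negb_or => /and5P[/and4P[ab ac ad ae] /and3P[bc bd be]
  /andP[cd ce] de _].
have CDV : C `|` D `<=` V by rewrite subUset.
have dd p q C' D' : p \in F -> q \in F -> p != q -> C' `<=` V -> D' `<=` V ->
    apart act (p, C') (q, D').
  by move=> pF qF pq C'V D'V; exact: apart_sub (dV p q pF qF pq) C'V D'V.
rewrite -(@cyc3_commutator _ _ _ C D a b c d e) //.
  by do ?[apply: BM | apply: BV].
by do ?split => //; apply: dd.
Qed.

(** Conjugating a cycle over [C] by cycles over the larger base [V]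
    changes its letters one at a time; through three fresh letters every triple
    can be reached from every other one. *)
Lemma cycles_in_spread V F C a b c :
  clopen V -> clopen C -> C `<=` V -> floors_apart V F -> uniq F ->
  (9 <= size F)%N -> cycles_in V F -> uniq [:: a; b; c] ->
  {subset [:: a; b; c] <= F} -> B (cyc3 act C a b c) -> cycles_in C F.
Proof.
move=> cV cC CV dV uF sF BV' u3 s3 B3.
have dC := floors_apart_sub CV dV.
pose P a b c := [/\ uniq [:: a; b; c], {subset [:: a; b; c] <= F} &
  B (cyc3 act C a b c)].
have memF (x y z : L) : {subset [:: x; y; z] <= F} ->
    [/\ x \in F, y \in F & z \in F].
  by move=> s; split; apply: s; rewrite !inE eqxx ?orbT.
have cyc (x y z : L) : P x y z -> P y z x.
  move=> [u s Bx]; have [xF yF zF] := memF _ _ _ s; split.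
  - by rewrite -(rot_uniq 1) /= in u.
  - by move=> t; rewrite !inE => /or3P[]/eqP->.
  - by rewrite -cyc3_cycle //; exact: floors_apart_floors3 dC u xF yF zF.
have rep (x y z d : L) : P x y z -> d \in F -> d \notin [:: x; y; z] -> P x y d.
  move=> [u s Bx] dF; have [xF yF zF] := memF _ _ _ s.
  rewrite !inE !negb_or => /and3P[dx dy dz].
  have [e eF] := @fresh_mem L 9 F [:: x; y; z; d] uF sF isT.
  rewrite !inE !negb_or => /and4P[ex ey ez ed].
  move: (u); rewrite /= !inE !negb_or => /andP[/andP[xy xz] /andP[yz _]].
  have u' : uniq [:: x; z; d].
    by rewrite /= !inE !negb_or xz eq_sym dx eq_sym dz.
  have u'' : uniq [:: x; y; d].
    by rewrite /= !inE !negb_or xy eq_sym dx eq_sym dy.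
  (* The commutator with a cycle on z, d and a spare letter e is (x d z); by
     [cyc3_prod] its inverse turns (x y z) into (x y d). *)
  have Bxdz : B (cyc3 act C x d z).
    rewrite -(setIidl CV).
    apply: (@cycles_in_commutator V F C V x y z d e) => //.
    - by rewrite /= !inE !negb_or xy xz yz ![_ == d]eq_sym ![_ == e]eq_sym
        dx dy dz ex ey ez ed.
    - by move=> t; rewrite !inE => /or4P[/eqP->|/eqP->|/eqP->|/orP[]/eqP->].
    - apply: BV' => //.
      by rewrite /= !inE !negb_or ![_ == d]eq_sym ![_ == e]eq_sym dz ez ed.
  have Bxzd : B (cyc3 act C x z d).
    rewrite -(invgK (cyc3 act C x z d)) cyc3_inv //; first exact: BV.
    exact: floors_apart_floors3 dC u' _ _ _.
  split=> //; first by move=> t; rewrite !inE => /or3P[]/eqP->.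
  rewrite -(@cyc3_prod _ _ act C x y z d) //; first exact: BM.
  by do ?split=> //; apply: dC => //; rewrite eq_sym.
have P0 : P a b c by [].
move=> a' b' c' u3' aF' bF' cF'.
have [aF bF cF] := memF _ _ _ s3.
(* Nine letters are needed here: six given ones and up to three fresh ones. *)
have fresh (s : seq L) : (size s <= 8)%N -> exists2 d, d \in F & d \notin s.
  by move=> s8; exact: (fresh_mem uF sF).
have [d1 d1F] := @fresh [:: a; b; c; a'; b'; c'] isT.
have [d2 d2F] := @fresh [:: a; b; c; a'; b'; c'; d1] isT.
have [d3 d3F] := @fresh [:: a; b; c; a'; b'; c'; d1; d2] isT.
rewrite !inE !negb_or => /and5P[h31 h32 h33 h34 /and4P[h35 h36 h37 h38]].
move=> /and5P[h21 h22 h23 h24 /and3P[h25 h26 h27]].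
move=> /and5P[h11 h12 h13 h14 /andP[h15 h16]].
move: u3'; rewrite /= !inE !negb_or => /andP[/andP[ab' ac'] /andP[bc' _]].
suff [] : P a' b' c' by [].
have P1 : P a b d1.
  by apply: rep P0 _ _ => //; rewrite !inE !negb_or h11 h12 h13.
have P2 : P b d1 d2.
  by apply: rep (cyc _ _ _ P1) _ _ => //; rewrite !inE !negb_or h22 h27 h21.
have P3 : P d1 d2 d3.
  by apply: rep (cyc _ _ _ P2) _ _ => //; rewrite !inE !negb_or h37 h38 h32.
have P4 : P d1 d2 a'.
  apply: rep P3 _ _ => //.
  by rewrite !inE !negb_or ![a' == _]eq_sym h14 h24 h34.
have P5 : P d2 a' b'.
  apply: rep (cyc _ _ _ P4) _ _ => //.
  by rewrite !inE !negb_or ![b' == _]eq_sym h25 ab' h15.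
apply: rep (cyc _ _ _ P5) _ _ => //.
by rewrite !inE !negb_or ![c' == _]eq_sym h26 ac' bc'.
Qed.

(** Two spare letters d and e make (a b c) over the intersection the
    commutator of (a d c) over [C] and (c b e) over [D]. *)
Lemma cycles_in_setI V F C D : clopen C -> clopen D -> C `<=` V -> D `<=` V ->
  floors_apart V F -> uniq F -> (5 <= size F)%N ->
  cycles_in C F -> cycles_in D F -> cycles_in (C `&` D) F.
Proof.
move=> cC cD CV DV dV uF sF BC BD a b c u3 aF bF cF.
have [d dF] := @fresh_mem L 5 F [:: a; b; c] uF sF isT.
have [e eF] := @fresh_mem L 5 F [:: a; b; c; d] uF sF isT.
move: (u3); rewrite /= !inE !negb_or => /andP[/andP[ab ac] /andP[bc _]].
move=> /and4P[ea eb ec ed] /and3P[da db dc].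
have h := (@cycles_in_commutator V F C D a d c b e).
apply: h => //.
- by rewrite /= !inE !negb_or [a == d]eq_sym [c == b]eq_sym ![_ == e]eq_sym
    ab ac bc ea eb ec ed da db dc.
- by move=> t; rewrite !inE => /or4P[/eqP->|/eqP->|/eqP->|/orP[]/eqP->].
- by apply: BC => //; rewrite /= !inE !negb_or ![_ == d]eq_sym da ac dc.
- apply: BD => //; rewrite /= !inE !negb_or ![_ == e]eq_sym ec eb.
  by rewrite eq_sym bc.
Qed.

Lemma cycles_in_setU F C D : clopen C -> clopen D -> C `&` D = set0 ->
  floors_apart (C `|` D) F -> cycles_in C F -> cycles_in D F ->
  cycles_in (C `|` D) F.
Proof.
move=> cC cD CD dF BC BD a b c u3 aF bF cF.
rewrite cyc3_setU //; last exact: floors_apart_floors3 dF u3 aF bF cF.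
by apply: BM; [exact: BC|exact: BD].
Qed.

Lemma cycles_in_setD F C V : clopen C -> clopen V -> C `<=` V ->
  floors_apart V F -> cycles_in C F -> cycles_in V F -> cycles_in (V `\` C) F.
Proof.
move=> cC cV CV dF BC BV' a b c u3 aF bF cF.
have E : V = C `|` (V `\` C) by rewrite setDUK.
have -> : cyc3 act (V `\` C) a b c = (cyc3 act C a b c)^-1 * cyc3 act V a b c.
  rewrite {2}E cyc3_setU ?mulKg //.
  - exact: clopen_setD.
  - by rewrite setDE setIC -setIA setICl setI0.
  - by rewrite -E; exact: floors_apart_floors3 dF u3 aF bF cF.
by apply: BM; [apply: BV; exact: BC|exact: BV'].
Qed.

Lemma cycles_in_set0 F : cycles_in set0 F.
Proof. by move=> a b c _ _ _ _; rewrite cyc3_set0. Qed.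

End Towers.

Section Orbits.
Variables (L : groupType) (X : topologicalType).
Variable act : group_hom L (homeo X).
Hypothesis hX : cantor_axioms X.

Lemma closed_points (s : seq X) : closed [set` s].
Proof.
have [_ hausX _ _] := hX.
have /accessible_finite_set_closed := hausdorff_accessible hausX; apply.
exact: finite_seq.
Qed.

(** An open set has infinitely many points, since the space has no
    isolated point. *)
Lemma open_avoid (U : set X) (s : seq X) : open U -> U !=set0 ->
  (U `\` [set` s]) !=set0.
Proof.
have [_ hausX _ perfX] := hX.
elim: s U => [|z s IH] U oU U0.
  by case: U0 => x Ux; exists x; split.
have oUz : open (U `\` [set` [:: z]]).
  rewrite setDE; apply: openI => //; apply: closed_openC.
  exact: closed_points.
have [|x [[Ux xz] xs]] := IH _ oUz.
  apply: contrapT => Uz0; case: U0 => x Ux; apply: (perfX z).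
  suff <- : U = [set z] by [].
  have Uz y : U y -> y = z.
    move=> Uy; apply: contrapT => yz; apply: Uz0; exists y; split=> //=.
    by rewrite inE => /eqP.
  by apply/seteqP; split=> [y /Uz|_ ->] //; rewrite -(Uz x Ux).
exists x; split=> //=; rewrite inE => /predU1P[xz'|//]; apply: xz => /=.
by rewrite inE xz'.
Qed.

Lemma orbit_avoid (x : X) (U : set X) (s : seq X) : minimal_action act ->
  open U -> U !=set0 -> exists l, U (act l x) /\ act l x \notin s.
Proof.
move=> minX oU U0.
have [|y [[Uy ys] [l _ E]]] := minX x _ (open_avoid s oU U0).
  rewrite setDE; apply: openI => //; apply: closed_openC.
  exact: closed_points.
by exists l; rewrite E; split=> //; exact/negP.
Qed.

Lemma nbhs_all (T : eqType) (x : X) (s : seq T) (Q : T -> set X -> Prop) :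
  (forall t V W, W `<=` V -> Q t V -> Q t W) ->
  (forall t, t \in s -> exists2 V, nbhs x V & Q t V) ->
  exists2 V, nbhs x V & forall t, t \in s -> Q t V.
Proof.
move=> Qsub; elim: s => [|t s IH] sQ.
  by exists [set: X] => //; exact: filterT.
have [V nV QV] := sQ t (mem_head t s).
have [|W nW QW] := IH; first by move=> u us; apply: sQ; rewrite inE us orbT.
exists (V `&` W); first exact: filterI.
move=> u; rewrite inE => /predU1P[->|/QW QuW].
  by apply: Qsub QV; exact: subIsetl.
by apply: Qsub QuW; exact: subIsetr.
Qed.

Lemma floors_apart_nbhs (x : X) (U : set X) (F : seq L) : nbhs x U ->
  uniq [seq act f x | f <- F] ->
  exists V, [/\ clopen V, V x, V `<=` U & floors_apart act V F].
Proof.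
move=> nU uF; have [_ hausX baseX _] := hX.
pose Q (t : L * L) V := t.1 != t.2 -> apart act (t.1, V) (t.2, V).
have [||W nW QW] := @nbhs_all _ x [seq (a, b) | a <- F, b <- F] Q.
- by move=> t V W WV QV ab; apply: (apart_sub (QV ab)).
- move=> _ /allpairsP[[a b] /= [aF bF ->]].
  have [->|ab] := eqVneq a b.
    by exists [set: X]; [exact: filterT|rewrite /Q eqxx].
  have abx : act a x != act b x.
    apply: contra_neq ab => abx.
    exact: (uniq_map_inj uF aF bF abx).
  have := hausX; rewrite open_hausdorff => /(_ _ _ abx)[[A A'] /= [Aa Ab]].
  move=> [oA oA' /eqP AA'].
  exists (act a @^-1` A `&` act b @^-1` A').
    apply: filterI.
      by apply: (@homeo_continuous _ (act a)); apply: open_nbhs_nbhs;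
        split=> //; rewrite inE in Aa.
    by apply: (@homeo_continuous _ (act b)); apply: open_nbhs_nbhs;
        split=> //; rewrite inE in Ab.
  move=> _ y z [/= Ay _] [_ A'z] e.
  have : set0 (act a y) by rewrite -AA'; split=> //; rewrite e.
  by [].
have [V [cV Vx VUW]] := baseX x _ (filterI nU nW).
exists V; split=> //; first by move=> y /VUW[].
move=> a b aF bF ab.
have abF : (a, b) \in [seq (a, b) | a <- F, b <- F] by exact: allpairs_f.
have VW : V `<=` W by move=> y /VUW[].
by apply: (apart_sub (QW _ abF ab)).
Qed.

End Orbits.

(** * Cycles over arbitrarily small clopen sets *)

Section Gating.
Variables (L : groupType) (X : topologicalType).
Variable act : group_hom L (homeo X).
Hypothesis hX : cantor_axioms X.
Let cX : compact [set: X]. Proof. by have [] := hX. Qed.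
Implicit Types (a b c d e f l : L) (C D V : set X) (x y z : X) (F : seq L).
Implicit Types (p q : set X * seq L).

(** A base with at least ten disjoint floors, one of them the base
    itself.  Ten letters leave room for [cycles_in_spread], which needs nine, and
    for choosing five floors away from five given points in [is_link]. *)
Definition is_tower p : Prop :=
  [/\ clopen p.1, uniq p.2, floors_apart act p.1 p.2, (10 <= size p.2)%N &
      1 \in p.2].

(** A link joins a tower based at x to a tower based at lx: over a common
    base near x it has five floors of the first and five floors of the second.
    Its ten floors are enough for [cycles_in_spread], and five on each side
    leave a choice when two points of the orbit must be avoided. *)
Definition is_link l p0 p q : Prop :=
  (exists s1 s2, [/\ q.2 = s1 ++ [seq f * l | f <- s2], size s1 = 5,
     size s2 = 5, {subset s1 <= p0.2} & {subset s2 <= p.2}]) /\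
  [/\ clopen q.1, uniq q.2, floors_apart act q.1 q.2, q.1 `<=` p0.1 &
      forall x, q.1 x -> p.1 (act l x)].

Definition letters (S : set L) : set L := [set l | S l \/ S l^-1].

Variables (S : set L) (B : set (homeo X)).
Variables (tw lk : set (set X * seq L)) (gates : set (set X)).

Definition tower_system : Prop :=
  [/\ finite_set tw, forall p, tw p -> is_tower p &
      forall x, exists2 p, tw p & p.1 x].

Definition link_system : Prop :=
  [/\ finite_set lk,
    forall q, lk q -> exists l p0 p, [/\ tw p0, tw p & is_link l p0 p q] &
    forall l p0 p x, letters S l -> tw p0 -> tw p -> p0.1 x ->
      p.1 (act l x) -> exists q, [/\ lk q, q.1 x & is_link l p0 p q]].

(** The sets to which the generating cycles are restricted: they
    separate points after translation, and contain the bases of the links. *)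
Definition gate_system : Prop :=
  [/\ finite_set gates, forall D, gates D -> clopen D, gates [set: X],
    forall q, lk q -> gates q.1 &
    forall x y, x <> y -> exists l, exists2 D, gates D &
      D (act l x) /\ ~ D (act l y)].

Hypothesis sB : is_subgroup B.
Hypothesis gS : generated_subgroup S = [set: L].
Hypothesis twP : tower_system.
Hypothesis lkP : link_system.
Hypothesis gtP : gate_system.
Hypothesis B_gate : forall p D, tw p -> gates D ->
  cycles_in act B (D `&` p.1) p.2.
Hypothesis B_link : forall q, lk q -> cycles_in act B q.1 q.2.

(** [D] can be used as a gate: every cycle of every tower, restricted to
    the part of its base inside [D], belongs to the group [B]. *)
Definition gated D : Prop :=
  clopen D /\ forall p, tw p -> cycles_in act B (D `&` p.1) p.2.

Lemma gated_gate D : gates D -> gated D.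
Proof.
have [_ cD _ _ _] := gtP => gD; split; first exact: cD.
by move=> p /B_gate; exact.
Qed.

Lemma gated_setT : gated [set: X].
Proof. by have [_ _ gT _ _] := gtP; exact: gated_gate. Qed.

Lemma B_tower p : tw p -> cycles_in act B p.1 p.2.
Proof. by have [_ h] := gated_setT; move=> /h; rewrite setTI. Qed.

Lemma gated_setI C D : gated C -> gated D -> gated (C `&` D).
Proof.
move=> [cC gC] [cD gD]; split=> [|p pT]; first exact: clopenI.
have [_ /(_ p pT)[cp up dp sp _] _] := twP.
rewrite (_ : C `&` D `&` p.1 = (C `&` p.1) `&` (D `&` p.1)).
  apply: (cycles_in_setI sB _ _ _ _ dp) => //.
  - exact: clopenI.
  - exact: clopenI.
  - exact: leq_trans sp.
  - exact: gC.
  - exact: gD.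
by rewrite setIACA setIid.
Qed.

Lemma gated_setC C : gated C -> gated (~` C).
Proof.
move=> [cC gC]; split=> [|p pT]; first exact: clopenC.
have [_ /(_ p pT)[cp up dp sp _] _] := twP.
rewrite (_ : ~` C `&` p.1 = p.1 `\` (C `&` p.1)).
  apply: (cycles_in_setD sB _ _ _ dp) => //.
  - exact: clopenI.
  - exact: gC.
  - exact: B_tower.
by rewrite setDIr setDv setU0 setDE setIC.
Qed.

Lemma gated_setD C D : gated C -> gated D -> gated (C `\` D).
Proof.
by move=> gC gD; rewrite setDE; apply: gated_setI => //; exact: gated_setC.
Qed.

(** A gated cycle on three floors common to the tower and to the link
    spreads to all floors of the link. *)
Lemma gated_link l p0 p q C : tw p0 -> is_link l p0 p q -> lk q ->
  gated C -> C `<=` q.1 -> cycles_in act B C q.2.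
Proof.
move=> twp0 [[s1 [s2 [q2 z1 z2 ss1 ss2]]] [cq uq dq qp0 qp]] lkq [cC gC] Cq.
have [_ /(_ p0 twp0)[c0 u0 d0 z0 _] _] := twP.
have C0 : cycles_in act B C p0.2.
  by have := gC p0 twp0; rewrite setIidl //; exact: subset_trans qp0.
case: s1 => [|a1 [|a2 [|a3 s1]]]// in q2 z1 ss1 *.
have sF : {subset [:: a1; a2; a3] <= q.2}.
  by rewrite q2 => t; rewrite !inE => /or3P[]/eqP->; rewrite eqxx ?orbT.
have u3 : uniq [:: a1; a2; a3].
  apply: subseq_uniq uq; rewrite q2 /= !eqxx; exact: sub0seq.
apply: (@cycles_in_spread _ _ _ _ sB q.1 q.2 C a1 a2 a3) => //.
- by rewrite q2 size_cat size_map z1 z2.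
- exact: B_link.
- by apply: C0 => //; apply: ss1; rewrite !inE eqxx ?orbT.
Qed.

(** Over each link the gating passes from the tower at x to the link and
    from the link to the tower at lx; the links cover the base, and gated sets
    form an algebra in which the cover can be made disjoint. *)
Lemma gated_translate l C : letters S l -> gated C -> gated (translate act l C).
Proof.
move=> Sl gC; split=> [|p pT]; first exact: translate_clopen gC.1.
have [_ /(_ p pT)[cp up dp sp _] twcov] := twP.
have [flk _ lkcov] := lkP.
pose Y := [set x | p.1 (act l x)].
have cY : clopen Y.
  split; first by apply: open_comp cp.1 => // x _; exact: homeo_continuous.
  by apply: preimage_closed cp.2 => // x _; exact: homeo_continuous.
(* Y is not yet known to be gated, so the algebra consists of traces on Y. *)
pose Alg U := exists2 U', gated U' & U = U' `&` Y.
pose P U := cycles_in act B (translate act l (C `&` U)) p.2.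
have YE U : U `<=` Y -> translate act l U `<=` p.1.
  by move=> UY x /UY; rewrite /Y /= act_invr.
have AlgY U : Alg U -> U `<=` Y by move=> [U' _ ->]; exact: subIsetr.
have AlgC U : Alg U -> clopen U.
  by move=> [U' [cU' _] ->]; exact: clopenI.
suff : P Y.
  rewrite /P (_ : translate act l (C `&` Y) = translate act l C `&` p.1) //.
  by apply/seteqP; split=> x [Cx]; rewrite /Y /= ?act_invr => px; split=> //;
    rewrite /Y /= ?act_invr.
apply: (@algebra_cover_ind _ Alg P
    [set Z | exists q p0, [/\ lk q, tw p0, is_link l p0 p q & Z = q.1]]).
- move=> U V [U' gU ->] [V' gV ->]; exists (U' `&` V').
    exact: gated_setI.
  by rewrite setIACA setIid.
- move=> U V [U' gU ->] [V' gV ->]; exists (U' `\` V').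
    exact: gated_setD.
  apply/seteqP; split=> [x [[U'x Yx] nV]|x [[U'x nV] Yx]].
    by do !split=> //; move=> V'x; apply: nV.
  by do !split=> //; move=> [].
- rewrite /P setI0 (_ : translate act l set0 = set0) //; exact: cycles_in_set0.
- move=> U V aU aV UV PU PV; rewrite /P.
  have -> : translate act l (C `&` (U `|` V)) =
     translate act l (C `&` U) `|` translate act l (C `&` V).
    by rewrite setIUr.
  apply: cycles_in_setU => //.
  + by apply: translate_clopen; apply: clopenI; [exact: gC.1|exact: AlgC].
  + by apply: translate_clopen; apply: clopenI; [exact: gC.1|exact: AlgC].
  + apply/seteqP; split=> // x [[_ Ux] [_ Vx]].
    by have : set0 (act l^-1 x) by rewrite -UV.
  + apply: floors_apart_sub dp; rewrite subUset; split; apply: YE.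
      by move=> x [_ /(AlgY _ aU)].
    by move=> x [_ /(AlgY _ aV)].
- apply: (sub_finite_set _ (finite_image fst flk)).
  by move=> Z [q [p0 [lq _ _ ->]]]; exists q.
- move=> Z [q [p0 [lkq twp0 linkq ->]]].
  have [_ _ _ gl _] := gtP.
  have [[s1 [s2 [q2 z1 z2 ss1 ss2]]] [cq uq dq qp0 qp]] := linkq.
  split; first by exists q.1; [exact/gated_gate/gl|rewrite setIidl].
  move=> U [U' gU' UE] Uq.
  have gU : gated U.
    suff -> : U = U' `&` q.1 by apply: gated_setI => //; exact/gated_gate/gl.
    by apply/seteqP; split=> [x Ux|x [U'x /qp Yx]];
      [split; [move: Ux; rewrite UE => -[]|exact: Uq]|rewrite UE].
  have gCU := gated_setI gC gU.
  have CUq : C `&` U `<=` q.1 by move=> x [_ /Uq].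
  have Bq := gated_link twp0 linkq lkq gCU CUq.
  case: s2 => [|b1 [|b2 [|b3 s2]]]// in q2 z2 ss2 *.
  have bq i : i \in [:: b1; b2; b3] -> i * l \in q.2.
    move=> i3; rewrite q2 mem_cat (map_f (fun f => f * l)) ?orbT //.
    by move: i3; rewrite !inE => /or3P[]/eqP->; rewrite eqxx ?orbT.
  have u3 : uniq [:: b1; b2; b3].
    have : uniq [seq f * l | f <- [:: b1, b2, b3 & s2]].
      by move: uq; rewrite q2 cat_uniq => /and3P[].
    move=> /map_uniq; apply: subseq_uniq; rewrite /= !eqxx; exact: sub0seq.
  have u3l : uniq [:: b1 * l; b2 * l; b3 * l].
    by rewrite (map_inj_uniq (@mulIg _ l) [:: b1; b2; b3]).
  have dCU : floors_apart act (C `&` U) q.2 by apply: floors_apart_sub dq.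
  apply: (@cycles_in_spread _ _ _ _ sB p.1 p.2 _ b1 b2 b3) => //.
  + exact: translate_clopen gCU.1.
  + by apply: YE => x [_ Ux]; exact: qp (Uq x Ux).
  + exact: leq_trans sp.
  + exact: B_tower.
  + move=> t t3; apply: ss2; move: t3; rewrite !inE.
    by move=> /or3P[]/eqP->; rewrite eqxx ?orbT.
  + rewrite cyc3_translate; last 2 first.
    * exact: gCU.1.
    * apply: floors_apart_floors3 dCU u3l _ _ _; apply: bq;
      by rewrite !inE eqxx ?orbT.
    by apply: Bq => //; apply: bq; rewrite !inE eqxx ?orbT.
- by exists [set: X]; [exact: gated_setT|rewrite setTI].
- move=> x Yx; have [p0 twp0 p0x] := twcov x.
  have [q [lkq qx qlink]] := lkcov l p0 p x Sl twp0 pT p0x Yx.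
  by exists q.1 => //; exists q, p0.
Qed.


Lemma translateM l m C :
  translate act (l * m) C = translate act l (translate act m C).
Proof. by rewrite predeqE => x; rewrite /translate /= invgM act_mul. Qed.

Lemma translate1 C : translate act 1 C = C.
Proof. by rewrite predeqE => x; rewrite /translate /= invg1 act_one. Qed.

Lemma gated_translate_all l C : gated C -> gated (translate act l C).
Proof.
pose H := [set l | (forall C, gated C -> gated (translate act l C)) /\
  forall C, gated C -> gated (translate act l^-1 C)].
suff /(_ l I)[h _] : [set: L] `<=` H by exact: h.
rewrite -gS; apply: smallest_sub.
  split=> [|a b [a1 a2] [b1 b2]|a [a1 a2]].
  - by split=> D; rewrite ?invg1 translate1.
  - split=> D gD; first by rewrite translateM; exact/a1/b1.
    by rewrite invgM translateM; exact/b2/a2.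
  - by split=> // D; rewrite invgK; exact: a1.
move=> a Sa; split=> D; apply: gated_translate; first by left.
by right; rewrite invgK.
Qed.

(** Gated sets form an algebra that is invariant under translation and
    separates points, so by compactness it contains all clopen sets. *)
Lemma gated_clopen C : clopen C -> gated C.
Proof.
move=> [oC cC].
have sep x y : x <> y -> exists D, [/\ gated D, D x & ~ D y].
  have [_ _ _ _ gsep] := gtP.
  move=> /gsep[l [D gD [Dx Dy]]]; exists (translate act l^-1 D).
  split; [|by rewrite /translate /= invgK..].
  exact/gated_translate_all/gated_gate.
have nearC x : C x -> exists D, [/\ gated D, D x & D `<=` C].
  move=> Cx.
  suff [D [gD Dx DC]] : exists D, [/\ gated D, D x & D `&` ~` C = set0].
    by exists D; split=> //; exact/subsets_disjoint.
  pose Q A := exists D, [/\ gated D, D x & D `&` A = set0].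
  apply: (@compact_ind X Q (~` C)).
  - by exists [set: X]; rewrite setI0; split=> //; exact: gated_setT.
  - move=> A A' AA [D [gD Dx DA]]; exists D; split=> //.
    by rewrite -subset0 -DA; exact: setIS.
  - move=> A A' [D [gD Dx DA]] [D' [gD' Dx' DA']]; exists (D `&` D').
    split=> //; first exact: gated_setI.
    apply/seteqP; split=> // z [[Dz D'z] [Az|A'z]].
      by have : set0 z by rewrite -DA.
    by have : set0 z by rewrite -DA'.
  - by apply: (subclosed_compact _ cX) => //; exact: open_closedC.
  - move=> y Cy; have [|D [gD Dx Dy]] := sep x y.
      by move=> xy; apply: Cy; rewrite -xy.
    exists (~` D); last by exists D; split=> //; rewrite setICr.
    apply: open_nbhs_nbhs; split=> //; exact: closed_openC gD.1.2.
suff [D [gD DC CD]] : exists D, [/\ gated D, D `<=` C & C `&` C `<=` D].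
  by rewrite (_ : C = D) //; apply/seteqP; split=> // x Cx; exact: CD.
pose Q A := exists D, [/\ gated D, D `<=` C & A `&` C `<=` D].
apply: (@compact_ind X Q C).
- exists set0; split=> //.
  by rewrite -setCT; apply: gated_setC; exact: gated_setT.
- move=> A A' AA [D [gD DC AD]]; exists D; split=> // x [/AA A'x Cx].
  exact: AD.
- move=> A A' [D [gD DC AD]] [D' [gD' DC' AD']]; exists (D `|` D'); split.
  + rewrite -(setCK (_ `|` _)) setCU; apply: gated_setC.
    by apply: gated_setI; exact: gated_setC.
  + by rewrite subUset.
  + by rewrite setIUl; exact: setUSS.
- exact: (subclosed_compact cC cX).
- move=> x /nearC[D [gD Dx DC]]; exists D.
    by apply: open_nbhs_nbhs; split=> //; exact: gD.1.1.
  by exists D; split=> //; exact: subIsetl.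
Qed.

Lemma tower_gated p C : tw p -> clopen C -> C `<=` p.1 -> cycles_in act B C p.2.
Proof.
by move=> twp /gated_clopen[_ /(_ p twp)] h Cp; move: h; rewrite setIidl.
Qed.

Lemma link_gated q C : lk q -> clopen C -> C `<=` q.1 -> cycles_in act B C q.2.
Proof.
move=> lkq /gated_clopen gC Cq.
have [_ /(_ q lkq)[l [p0 [p [tp0 _ lq]]]] _] := lkP.
exact: gated_link tp0 lq lkq gC Cq.
Qed.


(** The letters a, b, c are usable at [x]: over every small enough
    clopen set around [x] the cycle (a b c) belongs to the group [B]. *)
Definition good3 x a b c : Prop := exists V, [/\ clopen V, V x,
  floors3 act V a b c &
  forall C, clopen C -> C `<=` V -> B (cyc3 act C a b c)].

Definition good_family x F : Prop := exists V, [/\ clopen V, V x,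
  floors_apart act V F & forall C, clopen C -> C `<=` V -> cycles_in act B C F].

Let BM g h : B g -> B h -> B (g * h).
Proof. by have [_ BM _] := sB; exact: BM. Qed.
Let BV g : B g -> B g^-1.
Proof. by have [_ _ BV] := sB; exact: BV. Qed.

Lemma good3_uniq x a b c : good3 x a b c ->
  uniq [:: act a x; act b x; act c x].
Proof.
move=> [V [_ Vx [[ab [ac _]] [[bc _] _]] _]].
rewrite /= !inE !negb_or; apply/and3P; split=> //; last first.
  by apply/eqP; exact: bc.
by apply/andP; split; apply/eqP; [exact: ab|exact: ac].
Qed.

Lemma good3_cycle x a b c : good3 x a b c -> good3 x b c a.
Proof.
move=> [V [cV Vx f3 BV3]]; exists V; split=> //; first exact: floors3_cycle.
move=> C cC CV; rewrite -cyc3_cycle //; first exact: BV3.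
exact: floors3_sub CV f3.
Qed.

Lemma good3_translate x l a b c : good3 (act l x) a b c ->
  good3 x (a * l) (b * l) (c * l).
Proof.
move=> [V [cV Vx f3 BV3]].
have VE : translate act l (translate act l^-1 V) = V.
  by rewrite -translateM mulgV translate1.
have f3' : floors3 act (translate act l^-1 V) (a * l) (b * l) (c * l).
  by apply: (floors3_translate act l _ a b c).1; rewrite VE.
exists (translate act l^-1 V); split=> //; first exact: translate_clopen.
  by rewrite /translate /= invgK.
move=> C cC CV; rewrite -cyc3_translate //; last exact: floors3_sub CV f3'.
apply: BV3; first exact: translate_clopen.
by move=> y /CV; rewrite -[in X in _ -> X]VE.
Qed.

(** Conjugating (a b c) by (c d e) replaces c by d. *)
Lemma good3_move x a b c d e : good3 x a b c -> good3 x c d e ->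
  act d x \notin [:: act a x; act b x] ->
  act e x \notin [:: act a x; act b x] -> good3 x a b d.
Proof.
move=> g1 g2; have := good3_uniq g1; have := good3_uniq g2.
rewrite /= !inE !negb_or => /andP[/andP[cd ce] /andP[de _]].
move=> /andP[/andP[ab ac] /andP[bc _]] /andP[da db] /andP[ea eb].
move: g1 g2 => [V1 [cV1 V1x f1 B1]] [V2 [cV2 V2x f2 B2]].
pose F := [:: a; b; c; d; e].
have uFx : uniq [seq act f x | f <- F].
  by rewrite /= !inE !negb_or ![_ == act d x]eq_sym ![_ == act e x]eq_sym
    [act d x == act c x]eq_sym ab ac bc da db ea eb ![act e x == _]eq_sym
    ?cd ?ce ?de // ![_ == act e x]eq_sym ea eb ![act e x == _]eq_sym ce de.
have uF := map_uniq uFx.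
have [V [cV Vx VV dV]] := floors_apart_nbhs hX (filterI
  (open_nbhs_nbhs (conj cV1.1 V1x)) (open_nbhs_nbhs (conj cV2.1 V2x))) uFx.
have inF : [/\ a \in F, b \in F, c \in F & d \in F].
  by split; rewrite !inE eqxx ?orbT.
have [aF bF cF dF] := inF.
have [u3 u3' u3''] : [/\ uniq [:: a; b; d], uniq [:: a; c; d] &
    uniq [:: a; d; c]].
  move: uF; rewrite /= !inE !negb_or.
  move=> /and5P[/and4P[ab' ac' ad' _] /and3P[bc' bd' _] /andP[cd' _] _ _].
  by rewrite [d == c]eq_sym ab' ac' ad' bd' cd'.
exists V; split=> //; first exact: floors_apart_floors3 dV u3 _ _ _.
move=> C cC CV.
have Badc : B (cyc3 act C a d c).
  rewrite -(setIid C).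
  apply: (@cycles_in_commutator _ _ _ _ sB V F C C a b c d e) => //.
    by apply: B1 => // y /CV/VV[].
  by apply: B2 => // y /CV/VV[].
have dC := floors_apart_sub CV dV.
have Bacd : B (cyc3 act C a c d).
  rewrite -(invgK (cyc3 act C a c d)) cyc3_inv //; first exact: BV.
  exact: floors_apart_floors3 dC u3' _ _ _.
rewrite -(@cyc3_prod _ _ act C a b c d) //.
  by apply: BM => //; apply: B1 => // y /CV/VV[].
move: uF; rewrite /= !inE !negb_or.
move=> /and5P[/and4P[ab' ac' ad' _] /and3P[bc' bd' _] /andP[cd' _] _ _].
by do ?split=> //; apply: dC.
Qed.


Lemma good_family_points x F : good_family x F -> uniq F ->
  uniq [seq act f x | f <- F].
Proof.
move=> [V [_ Vx dV _]] uF; rewrite map_inj_in_uniq //.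
exact: floors_apart_inj dV Vx.
Qed.

Lemma good_family3 x F a b c : good_family x F -> uniq [:: a; b; c] ->
  a \in F -> b \in F -> c \in F -> good3 x a b c.
Proof.
move=> [V [cV Vx dV BVF]] u3 aF bF cF; exists V; split=> //.
  exact: floors_apart_floors3 dV u3 _ _ _.
by move=> C cC CV; exact: BVF.
Qed.

Lemma fresh_point x (G : seq L) (s : seq X) : uniq [seq act f x | f <- G] ->
  (size s < size G)%N -> exists2 f, f \in G & act f x \notin s.
Proof.
move=> uG sG.
have [||_ /mapP[f fG ->] fs] := @fresh_mem _ (size G) _ s uG.
- by rewrite size_map.
- exact: sG.
by exists f.
Qed.

(** For fixed letters a and b, the third letter of a usable triple is
    regarded as a token placed on the point [z] of the orbit of [x].  Only the
    point is recorded: distinct group elements may place the token on the same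
    point and differ nearby. *)
Definition token x a b z : Prop := exists2 l, act l x = z & good3 x a b l.

(** The token moves from one floor of a family to another as soon as a
    third floor avoids the points ax and bx, which it must not meet. *)
Lemma token_family x a b y F f0 f1 : good_family y F -> uniq F ->
  (5 <= size F)%N -> f0 \in F -> f1 \in F ->
  act f1 y \notin [:: act a x; act b x] ->
  token x a b (act f0 y) -> token x a b (act f1 y).
Proof.
move=> gF uF sF f0F f1F f1p [l lx gl].
have [<-|f01] := eqVneq f0 f1; first by exists l.
have uFp := good_family_points gF uF.
have [f2 f2F] := @fresh_point y F [:: act f0 y; act f1 y; act a x; act b x]
  uFp sF.
rewrite !inE !negb_or => /and4P[f20 f21 f2a f2b].
(* The token may sit at f0 y through an element l different from any
   translate of f0; the family is therefore rebased at x through l. *)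
pose g := f0^-1 * l.
have gx : act g x = y by rewrite act_mul lx act_invl.
have u3 : uniq [:: f0; f1; f2].
  rewrite /= !inE !negb_or f01 /=; apply/andP; split; last rewrite andbT.
    by apply: contra_neq f20 => ->.
  by apply: contra_neq f21 => ->.
have := good_family3 gF u3 f0F f1F f2F; rewrite -gx => /good3_translate.
rewrite [f0 * g]mulVKg => g3.
exists (f1 * g); first by rewrite act_mul.
apply: good3_move gl g3 _ _; rewrite act_mul gx //.
by rewrite !inE negb_or f2a f2b.
Qed.

Lemma tower_family p x : tw p -> p.1 x -> good_family x p.2.
Proof.
move=> twp px; have [_ /(_ p twp)[cp up dp _ _] _] := twP.
by exists p.1; split=> // C cC Cp; exact: tower_gated.
Qed.

(** The token reaches all admissible floors of the towers at [z].  The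
    floors are quantified, and not only [z] itself, because [z] may be one of
    the two forbidden points, which the token has to bypass. *)
Definition tokens_at x a b z : Prop := forall p f, tw p -> p.1 z ->
  f \in p.2 -> act f z \notin [:: act a x; act b x] -> token x a b (act f z).

Lemma tokens_step x a b z l : letters S l ->
  tokens_at x a b z -> tokens_at x a b (act l z).
Proof.
move=> Sl tz p f twp pz fp fz.
have [_ twt twc] := twP; have [_ _ lkc] := lkP.
have [p0 twp0 p0z] := twc z.
have [q [lkq qz [[s1 [s2 [q2 z1 z2 ss1 ss2]]] [cq uq dq qp0 qp]]]] :=
  lkc l p0 p z Sl twp0 twp p0z pz.
have gq : good_family z q.2.
  by exists q.1; split=> // C cC Cq; exact: link_gated.
have := good_family_points gq uq; rewrite q2 map_cat cat_uniq -map_comp.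
move=> /and3P[u1 _ u2].
have [|f1 f1s f1z] := @fresh_point z s1 [:: act a x; act b x] u1.
  by rewrite z1.
have u2' : uniq [seq act g (act l z) | g <- s2].
  by rewrite (eq_map (g := fun g => act (g * l) z)) // => g; rewrite act_mul.
have [|f2 f2s f2z] := @fresh_point _ s2 [:: act a x; act b x] u2'.
  by rewrite z2.
have t1 := tz p0 f1 twp0 p0z (ss1 _ f1s) f1z.
have t2 : token x a b (act (f2 * l) z).
  apply: token_family gq uq _ _ _ _ t1; rewrite ?q2.
  - by rewrite size_cat size_map z1 z2.
  - by rewrite mem_cat f1s.
  - by rewrite mem_cat (map_f (fun f => f * l)) ?orbT.
  - by rewrite act_mul.
rewrite act_mul in t2.
have [_ up dp sp _] := twt p twp.
apply: token_family (tower_family twp pz) up _ (ss2 _ f2s) fp fz t2.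
exact: leq_trans sp.
Qed.

Lemma tokens_everywhere x a b z l :
  tokens_at x a b z -> tokens_at x a b (act l z).
Proof.
pose H := [set l | (forall z, tokens_at x a b z -> tokens_at x a b (act l z)) /\
  forall z, tokens_at x a b z -> tokens_at x a b (act l^-1 z)].
suff /(_ l I)[h _] : [set: L] `<=` H by exact: h.
rewrite -gS; apply: smallest_sub.
  split=> [|c d [c1 c2] [d1 d2]|c [c1 c2]].
  - by split=> y; rewrite ?invg1 act_one.
  - split=> y ty; first by rewrite act_mul; exact/c1/d1.
    by rewrite invgM act_mul; exact/d2/c2.
  - by split=> // y; rewrite invgK; exact: c1.
move=> c Sc; split=> y; apply: tokens_step; first by left.
by right; rewrite invgK.
Qed.

(** Orbits are connected by generators, and towers and links let the
    token pass each generator, so it reaches the whole orbit. *)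
Lemma token_move x a b m l : good3 x a b m ->
  act l x \notin [:: act a x; act b x] -> token x a b (act l x).
Proof.
move=> gm lx; have [_ twt twc] := twP.
have tm : tokens_at x a b (act m x).
  move=> p f twp pm fp fm; have [_ up _ sp p1] := twt p twp.
  apply: token_family (tower_family twp pm) up _ p1 fp fm _.
    exact: leq_trans sp.
  by exists m => //; rewrite act_one.
have := @tokens_everywhere x a b (act m x) (l * m^-1) tm.
rewrite act_mul act_invl; have [p twp pl] := twc (act l x).
move=> /(_ p 1 twp pl); rewrite act_one; apply=> //.
by have [] := twt p twp.
Qed.

Lemma good3_start x : exists a b, good3 x 1 a b.
Proof.
have [_ twt twc] := twP; have [p twp px] := twc x.
have [_ up dp sp p1] := twt p twp.
have [a aF] := @fresh_mem _ 10 p.2 [:: 1] up sp isT.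
have [b bF] := @fresh_mem _ 10 p.2 [:: 1; a] up sp isT.
rewrite !inE negb_or => /andP[b1 ba] a1.
exists a, b; apply: good_family3 (tower_family twp px) _ p1 aF bF.
by rewrite /= !inE negb_or eq_sym a1 eq_sym b1 eq_sym ba.
Qed.

(** First the token moves one letter into [U], where it becomes the letter
    a; then the other letter is free to travel. *)
Lemma good_pair x (U : set X) (s : seq X) : minimal_action act ->
  open U -> U !=set0 ->
  exists a, [/\ U (act a x), act a x \notin s, x != act a x &
    forall l, act l x \notin [:: x; act a x] -> token x 1 a (act l x)].
Proof.
move=> minX oU U0; have [b [c g1bc]] := good3_start x.
have gc1b := good3_cycle (good3_cycle g1bc).
have [l [Ul]] := orbit_avoid hX x (act c x :: x :: s) minX oU U0.
rewrite !inE !negb_or => /and3P[lc lx ls].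
have [|a alx gc1a] := @token_move x c 1 b l gc1b.
  by rewrite !inE act_one negb_or lc lx.
have g1ac := good3_cycle gc1a.
exists a; rewrite alx; split=> //; first by rewrite eq_sym.
by move=> m mx; apply: (token_move g1ac); rewrite act_one alx.
Qed.

End Gating.

(** * A finite set of cycles generating a rich group *)

Section Existence.
Variables (L : groupType) (X : topologicalType).
Variable act : group_hom L (homeo X).
Hypothesis hX : cantor_axioms X.
Hypothesis minX : minimal_action act.

(** Clopen sets of diameter less than the expansivity constant cannot
    contain both points of a pair that has been moved apart. *)
Lemma expansive_separators (R : realType) : expansive_action R act ->
  exists P : set (set X), [/\ finite_set P, forall D, P D -> clopen D &
    forall x y, x <> y -> exists l, exists2 D, P D &
      D (act l x) /\ ~ D (act l y)].
Proof.
have [cX _ baseX _] := hX.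
move=> [d [delta [[[d0 dE dC dT] dN] delta0 dexp]]].
pose Rd (V : set X) (t : unit) := forall y z, V y -> V z -> (d y z < delta)%R.
have [||s [fs sP sT]] := @finite_clopen_cover X cX unit Rd [set: X].
- exact: closedT.
- move=> x _; have nx : nbhs x [set y | (d x y < delta / 2)%R].
    by apply/dN; exists (delta / 2)%R => //; exact: Num.Theory.divr_gt0.
  have [V [cV Vx Vd]] := baseX x _ nx.
  exists V, tt; split=> // y z /Vd/= xy /Vd/= xz.
  apply: Order.POrderTheory.le_lt_trans (dT y x z) _.
  rewrite (dC y x) [ltRHS](Num.Theory.splitr delta).
  exact: Num.Theory.ltrD.
exists (fst @` s); split.
- exact: finite_image.
- by move=> _ [p /sP[? _] <-].
- move=> x y /dexp[l dl]; have [p sp px] := sT (act l x) I.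
  exists l, p.1; first by exists p.
  split=> // py; have [_ /(_ _ _ px py)] := sP p sp.
  by rewrite Order.TotalTheory.ltNge dl.
Qed.

Lemma separated_letters x n : exists F : seq L,
  [/\ size F = n.+1, 1 \in F & uniq [seq act f x | f <- F]].
Proof.
elim: n => [|n [F [sF F1 uF]]]; first by exists [:: 1]; rewrite inE.
have [] := @orbit_avoid _ _ act hX x [set: X] [seq act f x | f <- F] minX.
- exact: openT.
- by exists x.
move=> l [_ lF]; exists (l :: F).
by rewrite /= sF inE F1 orbT lF.
Qed.

Lemma tower_exists x : exists (V : set X) (F : seq L),
  [/\ clopen V, V x & is_tower act (V, F)].
Proof.
have [F [sF F1 uF]] := separated_letters x 9.
have [V [cV Vx _ dV]] := floors_apart_nbhs hX (@filterT _ (nbhs x) _) uF.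
exists V, F; split=> //; split=> //; first exact: map_uniq uF.
by rewrite /= sF.
Qed.

Lemma link_exists l p0 p x : is_tower act p0 -> is_tower act p ->
  p0.1 x -> p.1 (act l x) ->
  exists (Z : set X) (F : seq L),
    [/\ clopen Z, Z x & is_link act l p0 p (Z, F)].
Proof.
move=> [c0 u0 d0 z0 _] [c1 u1 d1 z1 _] p0x px.
have U0 : uniq [seq act f x | f <- p0.2].
  by rewrite map_inj_in_uniq //; exact: floors_apart_inj d0 p0x.
have U1 : uniq [seq act f (act l x) | f <- p.2].
  by rewrite map_inj_in_uniq //; exact: floors_apart_inj d1 px.
pose s1 := take 5 p0.2; pose pts := [seq act f x | f <- s1].
pose ok f := act f (act l x) \notin pts.
pose s2 := take 5 [seq f <- p.2 | ok f].
have zs1 : size s1 = 5 by rewrite size_take (leq_trans _ z0).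
(* At most five floors at lx sit on one of the five points already chosen. *)
have zs2 : size s2 = 5.
  have : (size [seq f <- p.2 | ~~ ok f] <= 5)%N.
    rewrite -zs1 -(size_map (fun f => act f x) s1).
    rewrite -(size_map (fun f => act f (act l x)) [seq f <- p.2 | ~~ ok f]).
    apply: uniq_leq_size.
      by apply: subseq_uniq U1; apply: map_subseq; exact: filter_subseq.
    by move=> _ /mapP[f + ->]; rewrite mem_filter /ok negbK => /andP[].
  rewrite size_filter => bad; rewrite size_take size_filter.
  have := count_predC ok p.2; move: bad; rewrite /predC /= => bad cnt.
  suff : (5 <= count ok p.2)%N by rewrite leq_eqVlt => /predU1P[<-|->].
  rewrite -(leq_add2r 5) (leq_trans z1) // -cnt leq_add2l //.
have us2 : uniq [seq act f (act l x) | f <- s2].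
  apply: subseq_uniq U1; apply: map_subseq.
  by apply: subseq_trans (filter_subseq ok p.2); exact: take_subseq.
pose F := s1 ++ [seq f * l | f <- s2].
have uF : uniq [seq act f x | f <- F].
  rewrite map_cat cat_uniq -map_comp.
  rewrite (@eq_map _ _ _ (fun f => act f (act l x)) _ s2); last first.
    by move=> f; rewrite /= act_mul.
  rewrite us2 andbT; apply/andP; split.
    by apply: subseq_uniq U0; apply: map_subseq; exact: take_subseq.
  apply/hasPn => _ /mapP[f + ->] => /mem_take.
  by rewrite mem_filter => /andP[].
have nZ : nbhs x (p0.1 `&` [set y | p.1 (act l y)]).
  apply: filterI; first by apply: open_nbhs_nbhs; split=> //; exact: c0.1.
  apply: (@homeo_continuous _ (act l)).
  by apply: open_nbhs_nbhs; split=> //; exact: c1.1.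
have [Z [cZ Zx ZU dZ]] := floors_apart_nbhs hX nZ uF.
exists Z, F; split=> //; split.
  exists s1, s2; split=> //; first by move=> f /mem_take.
  by move=> f /mem_take; rewrite mem_filter => /andP[].
by split=> //; [exact: map_uniq uF|move=> y /ZU[]|move=> y /ZU[]].
Qed.

Definition cycles_on (p : set X * seq L) : set (homeo X) :=
  [set g | exists a b c, [/\ uniq [:: a; b; c], a \in p.2, b \in p.2,
     c \in p.2 & g = cyc3 act p.1 a b c]].

Lemma finite_cycles_on p : finite_set (cycles_on p).
Proof.
pose f (t : L * L * L) := cyc3 act p.1 t.1.1 t.1.2 t.2.
have fF := finite_seq p.2.
apply: (sub_finite_set _
  (finite_image f (finite_setX (finite_setX fF fF) fF))).
by move=> g [a [b [c [_ aF bF cF ->]]]]; exists (a, b, c).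
Qed.

Lemma cycles_on_alternating p : clopen p.1 -> floors_apart act p.1 p.2 ->
  cycles_on p `<=` alternating_full_group act.
Proof.
move=> cp dp g [a [b [c [u3 aF bF cF ->]]]].
by apply: cyc3_alternating => //; exact: floors_apart_floors3 dp u3 aF bF cF.
Qed.

(** The finite set consists of the cycles of a finite tower system,
    restricted to all gates, and of the cycles of a finite link system. *)
Lemma finite_cycle_system (R : realType) :
  finitely_generated L -> expansive_action R act ->
  exists S : set (homeo X), [/\ finite_set S,
    S `<=` alternating_full_group act &
    forall x (U : set X) (s : seq X), open U -> U !=set0 ->
      exists a, [/\ U (act a x), act a x \notin s, x != act a x &
        forall l, act l x \notin [:: x; act a x] ->
          token act (generated_subgroup S) x 1 a (act l x)]].
Proof.
move=> [Sig fSig gSig] /expansive_separators[P [fP cP sepP]].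
have [cX _ _ _] := hX.
have [||tw [ftw twP twT]] := @finite_clopen_cover X cX (seq L)
    (fun V F => is_tower act (V, F)) [set: X].
- exact: closedT.
- by move=> x _; exact: tower_exists.
have twt p : tw p -> is_tower act p by move=> /twP[_]; case: p.
have /choice[lkf lkfP] : forall t : L * ((set X * seq L) * (set X * seq L)),
    exists s : set (set X * seq L), tw t.2.1 -> tw t.2.2 ->
    [/\ finite_set s, forall q, s q -> is_link act t.1 t.2.1 t.2.2 q &
      forall x, t.2.1.1 x -> t.2.2.1 (act t.1 x) -> exists2 q, s q & q.1 x].
  move=> [l [p0 p]] /=.
  have [tw0|] := pselect (tw p0); last by exists set0.
  have [tw1|] := pselect (tw p); last by exists set0.
  have [||s [fs sP sT]] := @finite_clopen_cover X cX (seq L)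
    (fun V F => is_link act l p0 p (V, F)) (p0.1 `&` [set x | p.1 (act l x)]).
  - apply: closedI; first by have [[]] := twt _ tw0.
    have [[_ cp] _ _ _ _] := twt _ tw1.
    by apply: preimage_closed => // x _; exact: homeo_continuous.
  - by move=> x [p0x px]; exact: link_exists (twt _ tw0) (twt _ tw1) p0x px.
  exists s => _ _; split=> //; first by move=> [V F] /sP[].
  by move=> x p0x px; have [q] := sT x (conj p0x px); exists q.
pose triples := letters Sig `*` (tw `*` tw).
have ftriples : finite_set triples.
  apply: finite_setX; last exact: finite_setX.
  suff -> : letters Sig = Sig `|` (fun l => l^-1) @` Sig.
    by rewrite finite_setU; split=> //; exact: finite_image.
  apply/seteqP; split=> l [Sl|].
  - by left.
  - by move=> Sl; right; exists l^-1; rewrite ?invgK.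
  - by left.
  - by move=> [m Sm <-]; right; rewrite invgK.
pose lk := \bigcup_(t in triples) lkf t.
have flk : finite_set lk.
  apply: bigcup_finite => // -[l [p0 p]] [_ [/= tw0 tw1]].
  by have [] := lkfP (l, (p0, p)) tw0 tw1.
have lk_link q : lk q ->
    exists l p0 p, [/\ tw p0, tw p & is_link act l p0 p q].
  move=> [[l [p0 p]] [_ [/= tw0 tw1]] qs]; exists l, p0, p; split=> //.
  by have [_ h _] := lkfP (l, (p0, p)) tw0 tw1; exact: h.
pose gates := [set [set: X]] `|` P `|` fst @` lk.
have fgates : finite_set gates.
  rewrite !finite_setU; split; last exact: finite_image.
  by split=> //; exact: finite_set1.
have cgates D : gates D -> clopen D.
  move=> [[->|/cP//]|[q /lk_link[l [p0 [p [_ _ [_ []]]]]] + + + + + <-]] //.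
  exact: clopenT.
pose charts := [set (t.2 `&` t.1.1, t.1.2) | t in tw `*` gates] `|` lk.
have fcharts : finite_set charts.
  by rewrite finite_setU; split=> //; apply/finite_image/finite_setX.
pose S := \bigcup_(q in charts) cycles_on q.
exists S; split.
- by apply: bigcup_finite => // q _; exact: finite_cycles_on.
- move=> g [q [[[p D] [/= twp gD] <-]|lkq]]; apply: cycles_on_alternating => /=.
  + by apply: clopenI; [exact: cgates|have [] := twt p twp].
  + have [_ _ dp _ _] := twt p twp; apply: floors_apart_sub dp.
    exact: subIsetr.
  + by have [l [p0 [p [_ _ [_ []]]]]] := lk_link q lkq.
  + by have [l [p0 [p [_ _ [_ []]]]]] := lk_link q lkq.
have sB := is_subgroup_generated S.
have inB q : charts q -> cycles_in act (generated_subgroup S) q.1 q.2.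
  move=> cq a b c u3 aF bF cF; apply: sub_gen_smallest.
  by exists q => //; exists a, b, c.
move=> x U s oU U0.
apply: (@good_pair L X act hX Sig (generated_subgroup S) tw lk gates) => //.
- by split=> // y; have [p twp py] := twT y I; exists p.
- split=> // l p0 p y Sl tw0 tw1 p0y py.
  have [_ lkl lkc] := lkfP (l, (p0, p)) tw0 tw1.
  have [q sq qy] := lkc y p0y py; exists q; split=> //; last exact: lkl.
  by exists (l, (p0, p)).
- split=> //.
  + by left; left.
  + by move=> q lkq; right; exists q.
  + move=> y z /sepP[l [D PD Dl]]; exists l, D => //.
    by left; right.
- move=> p D twp gD; apply: (inB (D `&` p.1, p.2)).
  by left; exists (p, D).
- by move=> q lkq; apply: inB; right.
Qed.

End Existence.

(** * Totally disconnected locally compact groups *)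

Section CompactSets.
Variable T : topologicalType.
Hypothesis hT : hausdorff_space T.

(** The tube lemma, for a relation rather than an open set. *)
Lemma compact_tube (S : topologicalType) (K : set T) (s : S)
    (P : T -> S -> Prop) : compact K ->
  (forall x, K x -> exists A B, [/\ nbhs x A, nbhs s B &
     forall y t, A y -> B t -> P y t]) ->
  nbhs s [set t | forall x, K x -> P x t].
Proof.
move=> cK PK; pose Q A := exists2 B, nbhs s B & forall y t, A y -> B t -> P y t.
suff [B nB BP] : Q K by apply: filterS nB => t Bt x Kx; exact: BP.
apply: (@compact_ind T Q) => //.
- by exists [set: S] => //; exact: filterT.
- by move=> A A' AA [B nB BP]; exists B => // y t /AA; exact: BP.
- move=> A A' [B nB BP] [B' nB' BP']; exists (B `&` B'); first exact: filterI.
  by move=> y t [Ay|A'y] [Bt B't]; [exact: BP|exact: BP'].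
- by move=> x /PK[A [B [nA nB AB]]]; exists A => //; exists B.
Qed.

Lemma compact_separated (K K' : set T) : compact K -> compact K' ->
  K `&` K' = set0 ->
  exists U V, [/\ open U, open V, K `<=` U, K' `<=` V & U `&` V = set0].
Proof.
move=> cK cK' KK'.
pose sep (A A' : set T) :=
  exists U V, [/\ open U, open V, A `<=` U, A' `<=` V & U `&` V = set0].
have sepC A A' : sep A A' -> sep A' A.
  by move=> [U [V [? ? ? ? UV]]]; exists V, U; split=> //; rewrite setIC.
have sep_ind A' A : compact A -> (forall x, A x -> sep [set x] A') -> sep A A'.
  move=> cA Aloc; apply: (@compact_ind T (sep ^~ A')) => //.
  - exists set0, [set: T]; split=> //; [exact: open0|exact: openT|].
    by rewrite set0I.
  - move=> B C BC [U [V [oU oV CU ? ?]]]; exists U, V; split=> //.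
    exact: subset_trans CU.
  - move=> B C [U [V [oU oV BU A'V UV]]] [U' [V' [oU' oV' CU' A'V' UV']]].
    exists (U `|` U'), (V `&` V'); split.
    + exact: openU.
    + exact: openI.
    + exact: setUSS.
    + by rewrite subsetI.
    + apply/seteqP; split=> // z [[Uz|U'z] [Vz V'z]].
        by have : set0 z by rewrite -UV.
      by have : set0 z by rewrite -UV'.
  - move=> x /Aloc[U [V [oU oV xU A'V UV]]]; exists U.
      by apply: open_nbhs_nbhs; split=> //; exact: xU.
    by exists U, V; split.
apply: (sep_ind _ _ cK) => x Kx; apply: sepC; apply: (sep_ind _ _ cK') => y K'y.
have yx : y != x.
  by apply/eqP => yx; have : set0 x; [rewrite -KK'; split=> //; rewrite -yx|].
have := hT; rewrite open_hausdorff => /(_ _ _ yx)[[U V] /= [Uy Vx]].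
move=> [oU oV /eqP UV]; exists U, V; split=> //.
- by move=> _ ->; rewrite inE in Uy.
- by move=> _ ->; rewrite inE in Vx.
Qed.

Section QuasiComponent.
Variables (N : set T) (o : T).
Hypothesis cN : compact N.
Hypothesis No : N o.

Let relclopen C := [/\ C o, C `<=` N, closed C & closed (N `\` C)].
Let Q := [set x | forall C, relclopen C -> C x].

Let clN : closed N. Proof. exact: compact_closed. Qed.

Let relclopenN : relclopen N.
Proof. by split=> //; rewrite setDv; exact: closed0. Qed.

Let QN : Q `<=` N. Proof. by move=> x; apply. Qed.

Let avoid A : compact A -> A `&` Q = set0 ->
  exists2 C, relclopen C & C `&` A = set0.
Proof.
move=> cA AQ; pose P A := exists2 C, relclopen C & C `&` A = set0.
apply: (@compact_ind T P) => //.
- by exists N => //; rewrite setI0.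
- move=> B B' BB [C rC CB]; exists C => //.
  by apply/seteqP; split=> // z [Cz /BB B'z]; rewrite -CB.
- move=> B B' [C [Co CN cC cNC] CB] [C' [C'o C'N cC' cNC'] CB'].
  exists (C `&` C').
    split=> //; first by move=> z [/CN].
      exact: closedI.
    by rewrite setDIr; exact: closedU.
  apply/seteqP; split=> // z [[Cz C'z] [Bz|B'z]].
    by rewrite -CB.
  by rewrite -CB'.
- move=> x Ax; have : ~ Q x.
    by move=> Qx; have : set0 x by rewrite -AQ.
  move=> /existsNP[C /not_implyP[rC nCx]]; exists (~` C).
    apply: open_nbhs_nbhs; split=> //; apply: closed_openC.
    by have [] := rC.
  by exists C => //; rewrite setICr.
Qed.

Let closedQ : closed Q.
Proof.
rewrite (_ : Q = \bigcap_(C in relclopen) C) //.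
by apply: closed_bigI => C [].
Qed.

Let connectedQ : connected Q.
Proof.
move=> B B0 [O oO BO] [D cD BD].
have cQ : compact Q by exact: (subclosed_compact closedQ cN QN).
have clB : closed B by rewrite BD; exact: closedI.
have cB : compact B.
  by apply: (subclosed_compact clB cQ); rewrite BD; exact: subIsetl.
have clQB : closed (Q `\` B).
  rewrite (_ : Q `\` B = Q `&` ~` O).
    by apply: closedI => //; exact: open_closedC.
  apply/seteqP; split=> x [Qx nx]; split=> //.
    by move=> Ox; apply: nx; rewrite BO.
  by rewrite BO => -[].
have cQB : compact (Q `\` B) by apply: (subclosed_compact clQB cQ) => x [].
have [|U [V [oU oV BU QV UV]]] := compact_separated cB cQB.
  by rewrite setDE setIC -setIA setICl setI0.
have clUC : closed (~` U) by exact: open_closedC.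
have clVC : closed (~` V) by exact: open_closedC.
have [||C [Co CN cC cNC] CUV] := @avoid (N `&` (~` U `&` ~` V)).
- apply: (subclosed_compact _ cN); last exact: subIsetl.
  by apply: closedI => //; exact: closedI.
- apply/seteqP; split=> // x [[_ [Ux Vx]] Qx].
  have [Bx|Bx] := pselect (B x); first exact: (Ux (BU x Bx)).
  by apply: Vx; apply: QV.
have C_UV x : C x -> U x \/ V x.
  move=> Cx; apply: contrapT => /not_orP[Ux Vx].
  by have : set0 x; [rewrite -CUV; split=> //; split=> //; exact: CN|].
(* When C is covered by disjoint open sets, its part in each of them is again
   relatively clopen. *)
have half U' V' : open U' -> open V' -> U' `&` V' = set0 ->
    (forall x, C x -> U' x \/ V' x) -> U' o -> Q `<=` U'.
  move=> oU' oV' UV' CUV' U'o x Qx.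
  suff /(Qx _) [] : relclopen (C `&` U') by [].
  split=> //; first by move=> z [/CN].
    rewrite (_ : C `&` U' = C `&` ~` V').
      by apply: closedI => //; exact: open_closedC.
    apply/seteqP; split=> z [Cz]; split=> //.
      by move=> V'z; have : set0 z by rewrite -UV'.
    by have [//|] := CUV' z Cz.
  rewrite setDIr; apply: closedU => //; rewrite setDE; apply: closedI => //.
  exact: open_closedC.
have [Uo|Vo] := C_UV o Co.
  have QU := half U V oU oV UV C_UV Uo.
  apply/seteqP; split=> [x|x Qx]; first by rewrite BD => -[].
  apply: contrapT => nBx.
  by have : set0 x by rewrite -UV; split; [exact: QU|exact: QV].
have QV' : Q `<=` V.
  apply: (half V U) => //; first by rewrite setIC.
  by move=> x /C_UV[]; [right|left].
case: B0 => x Bx; have Qx : Q x by move: Bx; rewrite BD => -[].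
by have : set0 x by rewrite -UV; split; [exact: BU|exact: QV'].
Qed.

(** In a compact Hausdorff space components and quasi-components
    agree, which gives a relatively clopen set around [o] that avoids the
    boundary of [N]; inside the interior of [N] it is open in the whole space. *)
Lemma compact_open_nbhs (O : set T) :
  connected_component [set: T] o = [set o] -> nbhs o N -> nbhs o O ->
  exists C, [/\ compact C, open C, C o & C `<=` O].
Proof.
move=> comp_o nN nO.
have Qo : Q `<=` [set o].
  rewrite -comp_o; apply: connected_component_max => //.
  by move=> C [].
pose W := (N `&` O)°.
have oW : open W by exact: open_interior.
have Wo : W o by apply: nbhs_singleton; apply: nbhs_interior; exact: filterI.
have [||C [Co CN cC cNC] CW] := @avoid (N `\` W).
- apply: (subclosed_compact _ cN); last exact: subDsetl.
  by rewrite setDE; apply: closedI => //; exact: open_closedC.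
- by apply/seteqP; split=> // x [[_ nW] /Qo xo]; apply: nW; rewrite xo.
have CsubW : C `<=` W.
  move=> x Cx; apply: contrapT => nWx.
  by have : set0 x; [rewrite -CW; split=> //; split=> //; exact: CN|].
exists C; split=> //.
- exact: (subclosed_compact cC cN CN).
- rewrite (_ : C = W `&` ~` (N `\` C)).
    by apply: openI => //; exact: closed_openC.
  apply/seteqP; split=> [x Cx|x [Wx nNC]].
    by split=> [|[]]; first exact: CsubW.
  apply: contrapT => nCx; apply: nNC; split=> //.
  by have [] := interior_subset Wx.
- by move=> x /CsubW/interior_subset[].
Qed.

End QuasiComponent.
End CompactSets.

Section TopGroup.
Variable G : topGroupType.
Implicit Types (g h k : G) (U V O K : set G).

Lemma nbhs_mul g h U : nbhs (g * h) U ->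
  exists A A', [/\ nbhs g A, nbhs h A' & forall x y, A x -> A' y -> U (x * y)].
Proof.
move=> nU; have := @mulg_continuous G (g, h) U nU.
move=> [[A A'] /= [nA nA'] AU]; exists A, A'; split=> // x y Ax A'y.
by have := AU (x, y); apply.
Qed.

Lemma nbhs_inv g U : nbhs g^-1 U -> nbhs g [set x | U x^-1].
Proof. exact: (@invg_continuous G g U). Qed.

Lemma nbhs_mull g h U : nbhs (g * h) U -> nbhs h [set x | U (g * x)].
Proof.
move=> /nbhs_mul[A [A' [nA nA' AU]]]; apply: filterS nA' => x A'x.
by apply: AU => //; exact: nbhs_singleton.
Qed.

Lemma nbhs_mulr g h U : nbhs (g * h) U -> nbhs g [set x | U (x * h)].
Proof.
move=> /nbhs_mul[A [A' [nA nA' AU]]]; apply: filterS nA => x Ax.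
by apply: AU => //; exact: nbhs_singleton.
Qed.

Lemma nbhs1_translate g U : nbhs 1 U -> nbhs g [set x | U (x * g^-1)].
Proof. by move=> nU; apply: nbhs_mulr; rewrite mulgV. Qed.

Lemma nbhs1_translatel g U : nbhs 1 U -> nbhs g [set x | U (g^-1 * x)].
Proof. by move=> nU; apply: nbhs_mull; rewrite mulVg. Qed.

Lemma closed_subgroup K : is_subgroup K -> nbhs 1 K -> closed K.
Proof.
move=> [K1 KM KV] nK; rewrite -openC openE => g nKg.
apply: filterS (nbhs1_translatel g nK) => x Kx Kx'; apply: nKg.
have -> : g = x * (g^-1 * x)^-1 by rewrite invgM invgK mulVKg.
by apply: KM => //; exact: KV.
Qed.

(** The component of 1 is closed, so points are closed, and division
    is continuous. *)
Lemma totally_disconnected_hausdorff :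
  totally_disconnected [set: G] -> hausdorff_space G.
Proof.
move=> tdG x y xy; apply: contrapT => nxy.
have cl1 : closed [set (1 : G)].
  by rewrite -(tdG 1 I); apply: component_closed; exact: closedT.
have nU : nbhs (x^-1 * y) (~` [set (1 : G)]).
  apply: open_nbhs_nbhs; split; first exact: closed_openC.
  by move=> /= /mulg1_eq; rewrite invgK; exact: nxy.
have [A [A' [/nbhs_inv + nA' AU]]] := nbhs_mul nU.
rewrite /= => nA; have [z [Az A'z]] := xy _ _ nA nA'.
by apply: (AU _ _ Az A'z); rewrite /= mulVg.
Qed.

Hypothesis tdlcG : tdlc G.

Lemma tdlc_hausdorff : hausdorff_space G.
Proof. exact: totally_disconnected_hausdorff tdlcG.2. Qed.

(** A compact open neighbourhood of 1 has an open stabiliser under right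
    translation, and contains it. *)
Lemma van_dantzig O : nbhs 1 O ->
  exists K, [/\ is_subgroup K, compact K, nbhs 1 K & K `<=` O].
Proof.
move=> nO; have [lcG tdG] := tdlcG.
have [N] := lcG 1 I; rewrite withinET => nN [cN _].
have [C [cC oC C1 CO]] := compact_open_nbhs tdlc_hausdorff cN
  (nbhs_singleton nN) (tdG 1 I) nN nO.
pose K := [set g | forall c, C c -> C (c * g) /\ C (c * g^-1)].
have sK : is_subgroup K.
  split=> [c Cc|g h Kg Kh c Cc|g Kg c Cc].
  - by rewrite invg1 mulg1.
  - rewrite invgM !mulgA; split.
      by have [/Kh[]] := Kg c Cc.
    by have [_ /Kg[]] := Kh c Cc.
  - by rewrite invgK; have [] := Kg c Cc.
have nK : nbhs 1 K.
  apply: (compact_tube cC) => c Cc.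
  have nC : nbhs c C by apply: open_nbhs_nbhs.
  have nC1 : nbhs (c * 1) C by rewrite mulg1.
  have nC1' : nbhs (c * 1^-1) C by rewrite invg1 mulg1.
  have [A [A' [nA nA' AC]]] := nbhs_mul nC1.
  have [B [B' [nB /nbhs_inv nB' BC]]] := nbhs_mul nC1'.
  exists (A `&` B), (A' `&` [set x | B' x^-1]).
  split; [exact: filterI|exact: filterI|].
  by move=> y t [Ay By] [A't B't]; split; [exact: AC|exact: BC].
have KC : K `<=` C by move=> g /(_ 1 C1); rewrite mul1g => -[].
exists K; split=> //; last exact: subset_trans CO.
by apply: (subclosed_compact _ cC KC); exact: closed_subgroup.
Qed.

(** The intersection of the conjugates of an open subgroup by a compact
    group is still a neighbourhood of 1. *)
Lemma small_normal_subgroup K O : is_subgroup K -> compact K -> nbhs 1 O ->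
  exists N, [/\ is_subgroup N, nbhs 1 N, N `<=` O &
    forall k g, K k -> N g -> N (k * g * k^-1)].
Proof.
move=> [K1 KM KV] cK /van_dantzig[M [[M1 MM MV] _ nM MO]].
exists [set g | forall k, K k -> M (k * g * k^-1)]; split.
- split=> [k Kk|g h Mg Mh k Kk|g Mg k Kk].
  + by rewrite mulg1 mulgV.
  + have -> : k * (g * h) * k^-1 = (k * g * k^-1) * (k * h * k^-1).
      by rewrite !mulgA mulgVK.
    by apply: MM; [exact: Mg|exact: Mh].
  + have -> : k * g^-1 * k^-1 = (k * g * k^-1)^-1.
      by rewrite !invgM invgK mulgA.
    exact/MV/Mg.
- apply: (compact_tube cK) => k Kk.
  have nM1 : nbhs (k * 1 * k^-1) M by rewrite mulg1 mulgV.
  have [A [A' [nA /nbhs_inv nA' AM]]] := nbhs_mul nM1.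
  have [B [B' [nB nB' BA]]] := nbhs_mul nA.
  exists (B `&` [set x | A' x^-1]), B'; split=> //; first exact: filterI.
  by move=> y t [By A'y] B't; apply: AM => //; exact: BA.
- by move=> g /(_ 1 K1); rewrite mul1g invg1 mulg1 => /MO.
- move=> k g Kk Ng k' Kk'.
  have -> : k' * (k * g * k^-1) * k'^-1 = (k' * k) * g * (k' * k)^-1.
    by rewrite invgM !mulgA.
  by apply: Ng; exact: KM.
Qed.

Lemma compact_conj (K : set G) g :
  compact K -> compact [set k * g * k^-1 | k in K].
Proof.
move=> cK; apply: (@continuous_compact _ _ (fun k => k * g * k^-1)) => //.
apply: continuous_subspaceT => k U.
move=> /nbhs_mul[A [A' [nA /nbhs_inv nA' AU]]].
apply: filterS (filterI (nbhs_mulr nA) nA') => x [Ax A'x].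
exact: AU.
Qed.

Lemma compact_finite_cosets (C N : set G) : compact C -> nbhs 1 N ->
  exists s : seq G, forall c, C c -> exists2 t, t \in s & N (c * t^-1).
Proof.
move=> cC nN.
apply: (@compact_ind G (fun A => exists s : seq G,
  forall c, A c -> exists2 t, t \in s & N (c * t^-1))) => //.
- by exists [::].
- by move=> A B AB [s sP]; exists s => c /AB; exact: sP.
- move=> A B [s sP] [t tP]; exists (s ++ t) => c [/sP|/tP] [u us Nu];
  by exists u => //; rewrite mem_cat us ?orbT.
- move=> c Cc; exists [set x | N (x * c^-1)]; first exact: nbhs1_translate.
  by exists [:: c] => x Nx; exists c => //; rewrite inE.
Qed.

End TopGroup.

(** * Conjugacy in the group generated by finitely many cycles *)

Lemma pigeonhole (T U : eqType) (f : T -> U) (ks : seq T) (s : seq U) :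
  uniq ks -> (size s < size ks)%N -> {in ks, forall k, f k \in s} ->
  exists i j, [/\ i \in ks, j \in ks, i != j & f i = f j].
Proof.
move=> uks sks fs; apply: contrapT => ninj.
have injf : {in ks &, injective f}.
  move=> i j iks jks fij; apply: contrapT => /eqP ij; apply: ninj.
  by exists i, j.
suff : (size ks <= size s)%N by rewrite leqNgt sks.
rewrite -(size_map f); apply: uniq_leq_size; first by rewrite map_inj_in_uniq.
by move=> _ /mapP[k kks ->]; exact: fs.
Qed.

(** If r commutes with h, the commutators of r with g and with g h^-1
    coincide; the right-hand side shows that it lies in any normal subgroup
    that contains g h^-1. *)
Lemma commutator_quotient (H : groupType) (g h r : H) : h * r = r * h ->
  g * r * g^-1 * r^-1 = (g * h^-1) * (r * (g * h^-1)^-1 * r^-1).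
Proof.
move=> hr; have E : h^-1 * r = r * h^-1.
  by apply: (@mulIg _ h); rewrite mulgVK -mulgA -hr mulKg.
by rewrite invgM invgK !mulgA -(mulgA g h^-1 r) E !mulgA mulgVK.
Qed.

Lemma commutator_conj (H : groupType) (g h d : H) :
  g * h * g^-1 * h^-1 = d^-1 * ((d * g * d^-1) * (d * h * d^-1) *
    (d * g * d^-1)^-1 * (d * h * d^-1)^-1) * d^-1^-1.
Proof. by rewrite !invgM !invgK !mulgA mulVg mul1g !mulgVK. Qed.

Lemma commute_support (X : topologicalType) (g h : homeo X) :
  (forall x, g x = x \/ h x = x) -> g * h = h * g.
Proof.
move=> gh; apply: homeoP => x; rewrite !homeoME.
have [gx|gx] := pselect (g x = x).
  have [hx|hx] := pselect (h x = x); first by rewrite hx gx hx.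
  have [->|/homeo_inj//] := gh (h x); by rewrite gx.
have [//|hx] := gh x; rewrite hx.
have [/homeo_inj//|->//] := gh (g x).
Qed.

Section NoCover.
Variables (L : groupType) (X : topologicalType).
Variable act : group_hom L (homeo X).
Hypothesis hX : cantor_axioms X.
Hypothesis minX : minimal_action act.
Local Notation A := (alternating_full_group act).

Variable G : topGroupType.
Hypothesis tdlcG : tdlc G.
Variable psi : homeo X -> G.
Hypothesis psiM : forall g h, A g -> A h -> psi (g * h) = psi g * psi h.
Hypothesis psi_inj : forall g, A g -> psi g = 1 -> g = 1.

Let sA : is_subgroup A. Proof. exact: is_subgroup_generated. Qed.
Let A1 : A 1. Proof. by have [] := sA. Qed.
Let AM g h : A g -> A h -> A (g * h).
Proof. by have [_ AM _] := sA; exact: AM. Qed.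
Let AV g : A g -> A g^-1.
Proof. by have [_ _ AV] := sA; exact: AV. Qed.

Lemma psi1 : psi 1 = 1.
Proof.
by apply: (@mulgI _ (psi 1)); rewrite -psiM // !mulg1.
Qed.

Lemma psiV g : A g -> psi g^-1 = (psi g)^-1.
Proof.
by move=> Ag; apply/esym/mulg1_eq; rewrite -psiM ?mulgV ?psi1 //; exact: AV.
Qed.

Variable S : set (homeo X).
Hypothesis SA : S `<=` A.
Local Notation B := (generated_subgroup S).
Hypothesis S_pairs : forall x (U : set X) (s : seq X), open U -> U !=set0 ->
  exists a, [/\ U (act a x), act a x \notin s, x != act a x &
    forall l, act l x \notin [:: x; act a x] -> token act B x 1 a (act l x)].

Let BA : B `<=` A. Proof. exact: smallest_sub. Qed.
Let sB : is_subgroup B. Proof. exact: is_subgroup_generated. Qed.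
Let B1 : B 1. Proof. by have [] := sB. Qed.
Let BM g h : B g -> B h -> B (g * h).
Proof. by have [_ BM _] := sB; exact: BM. Qed.
Let BV g : B g -> B g^-1.
Proof. by have [_ _ BV] := sB; exact: BV. Qed.

Definition fixes (W : set X) (g : homeo X) : Prop := forall x, W x -> g x = x.

Definition supported (W : set X) (g : homeo X) : Prop :=
  forall x, ~ W x -> g x = x.

Lemma fixes_subgroup W : is_subgroup (fixes W).
Proof.
split=> [//|g h fg fh x Wx|g fg x Wx]; first by rewrite homeoME fh // fg.
by rewrite homeoVE -[in LHS](fg x Wx) homeoK.
Qed.

Lemma supported_subgroup W : is_subgroup (supported W).
Proof.
split=> [//|g h fg fh x Wx|g fg x Wx]; first by rewrite homeoME fh // fg.
by rewrite homeoVE -[in LHS](fg x Wx) homeoK.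
Qed.

Lemma fixes_supported_commute W g h :
  fixes W g -> supported W h -> g * h = h * g.
Proof.
move=> fg sh; apply: commute_support => x.
by have [/fg|/sh] := pselect (W x); [left|right].
Qed.

Lemma cyc3_supported (C W : set X) a b c : clopen C -> floors3 act C a b c ->
  (forall y, C y -> W (act a y)) -> (forall y, C y -> W (act b y)) ->
  (forall y, C y -> W (act c y)) -> supported W (cyc3 act C a b c).
Proof.
move=> cC f3 Wa Wb Wc x nWx; have [_ _ _ off] := cyc3P cC f3.
by apply: off => y Cy yx; apply: nWx; rewrite -yx;
  [exact: Wa|exact: Wb|exact: Wc].
Qed.

(** Conjugation by [d j] moves the support of [c0] over [V] from the letter
    c to the letter j, and conjugation by [d i] turns the other cycle into one
    on the letters i, p and c over [U]; these supports are disjoint. *)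
Lemma conj_commute (U V : set X) (c z p i j : L) (c0 : homeo X) :
  clopen U -> clopen V -> U `<=` V -> uniq [:: c; z; p; i; j] ->
  floors_apart act V [:: c; z; p; i; j] ->
  (forall m, m \in [:: z; p; i; j] ->
     forall y, V y -> c0 (act m y) = act m y) ->
  let d k := cyc3 act V c k z in
  (d j * c0 * (d j)^-1) * (d i * cyc3 act U c p z * (d i)^-1) =
  (d i * cyc3 act U c p z * (d i)^-1) * (d j * c0 * (d j)^-1).
Proof.
move=> cU cV UV + dV c0fix d; rewrite /= !inE !negb_or.
move=> /and5P[/and4P[cz cp ci cj] /and3P[zp zi zj] /andP[pi pj] ij _].
have neq m n y u : m \in [:: c; z; p; i; j] -> n \in [:: c; z; p; i; j] ->
    m != n -> V y -> V u -> act m y <> act n u.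
  by move=> mF nF mn Vy Vu; exact: dV mF nF mn _ _ Vy Vu.
have [cF zF pF iF jF] : [/\ c \in [:: c; z; p; i; j], z \in [:: c; z; p; i; j],
    p \in [:: c; z; p; i; j], i \in [:: c; z; p; i; j] &
    j \in [:: c; z; p; i; j]] by split; rewrite !inE eqxx ?orbT.
have f3 k : k \in [:: p; i; j] -> floors3 act V c k z.
  by rewrite !inE => /or3P[]/eqP->; do ?split=> //; apply: dV;
    rewrite // eq_sym.
have f3i : floors3 act V c i z by apply: f3; rewrite !inE eqxx ?orbT.
have f3j : floors3 act V c j z by apply: f3; rewrite !inE eqxx ?orbT.
have f3p : floors3 act U c p z.
  by apply: (floors3_sub UV); apply: f3; rewrite !inE eqxx ?orbT.
have [ic ii iz ioff] := cyc3P cV f3i; have [jc jj jz joff] := cyc3P cV f3j.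
have [pc pp pz poff] := cyc3P cU f3p.
rewrite -/(d i) in ic ii iz ioff; rewrite -/(d j) in jc jj jz joff.
have fixj v : c0 v = v -> (d j * c0 * (d j)^-1) (d j v) = d j v.
  by move=> c0v; rewrite !homeoME homeoVE homeoK c0v.
apply: commute_support => x; pose u := homeo_inv (d i) x.
have xE : x = d i u by rewrite homeo_invK.
have [[y Uy uE]|nc] := floors_pick act U c u.
  have Vy := UV y Uy; left; rewrite xE uE ic //.
  have jiy : d j (act i y) = act i y.
    by apply: joff => t Vt; apply: neq => //; rewrite eq_sym.
  rewrite -jiy fixj //; apply: c0fix => //.
  by rewrite !inE eqxx ?orbT.
have [[y Uy uE]|np] := floors_pick act U p u.
  have Vy := UV y Uy; left; rewrite xE uE.
  have -> : d i (act p y) = act p y.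
    by apply: ioff => t Vt; apply: neq => //; rewrite eq_sym.
  have jpy : d j (act p y) = act p y.
    by apply: joff => t Vt; apply: neq => //; rewrite eq_sym.
  rewrite -jpy fixj //; apply: c0fix => //.
  by rewrite !inE eqxx ?orbT.
have [[y Uy uE]|nz] := floors_pick act U z u.
  have Vy := UV y Uy; left; rewrite xE uE iz // -(jz y Vy) fixj //.
  by apply: c0fix => //; rewrite !inE eqxx.
by right; rewrite xE !homeoME homeoVE homeoK poff.
Qed.

(** Each new point is chosen away from the previous ones, and the token
    is sent there. *)
Lemma many_tokens (y : X) (U : set X) (z : L) (n : nat) :
  open U -> U !=set0 -> y != act z y ->
  (forall l, act l y \notin [:: y; act z y] -> token act B y 1 z (act l y)) ->
  exists ks : seq L, [/\ size ks = n,
    uniq (y :: act z y :: [seq act k y | k <- ks]) &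
    forall k, k \in ks -> U (act k y) /\ good3 act B y 1 z k].
Proof.
move=> oU U0 yz tok; elim: n => [|n [ks [sks uks ksP]]].
  by exists [::]; rewrite /= inE yz.
have [l [Ul]] := orbit_avoid hX y (y :: act z y :: [seq act k y | k <- ks])
  minX oU U0.
rewrite !inE !negb_or => /and3P[ly lz lks].
have [|k kl gk] := tok l; first by rewrite !inE negb_or ly lz.
exists (k :: ks); split=> [||m]; first by rewrite /= sks.
  move: uks; rewrite /= !inE !negb_or kl ![_ == act l y]eq_sym ly lz lks.
  by move=> /andP[/andP[-> ->] /andP[-> ->]].
by rewrite inE => /predU1P[->|/ksP//]; rewrite kl.
Qed.

Section Factor.
Variables (K : set G) (W : set X).
Hypothesis sK : is_subgroup K.

Definition factors g : Prop :=
  exists l k, [/\ A l, fixes W l, K k & g = psi l * k].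

(** The elements b with K b K inside F K, where F is the group of
    elements trivial on [W], are stable under products:
    K b b' K is contained in F K b' K, hence in F K. *)
Lemma generated_factors :
  (forall s k k', S s \/ S s^-1 -> K k -> K k' ->
     factors (k * psi s * k')) ->
  forall b, B b -> factors (psi b).
Proof.
move=> Sf b; have [K1 KM KV] := sK; have [f1 fM fV] := fixes_subgroup W.
pose M b := forall k k', K k -> K k' -> factors (k * psi b * k').
suff /[apply] -[_ Mb _] : B `<=` [set b | [/\ A b, M b & M b^-1]].
  by have := Mb 1 1 K1 K1; rewrite mul1g mulg1.
have MM g h : A g -> A h -> M g -> M h -> M (g * h).
  move=> Ag Ah Mg Mh k k' Kk Kk'; rewrite psiM //.
  have [l [k1 [Al fl Kk1 E]]] := Mg k 1 Kk K1; rewrite mulg1 in E.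
  have [l' [k2 [Al' fl' Kk2 E']]] := Mh k1 k' Kk1 Kk'.
  exists (l * l'), k2; split; [exact: AM|exact: fM|by []|].
  by rewrite psiM // -(mulgA (psi l)) -E' !mulgA -E.
apply: smallest_sub.
  split=> [|g h [Ag Mg MgV] [Ah Mh MhV]|g [Ag Mg MgV]].
  - have M1 : M 1.
      move=> k k' Kk Kk'; exists 1, (k * k').
      by split=> //; rewrite ?psi1 ?mulg1 ?mul1g //; exact: KM.
    by split=> //; rewrite invg1.
  - by split; [exact: AM|exact: MM|rewrite invgM; apply: MM => //; exact: AV].
  - by split; [exact: AV|by []|rewrite invgK].
move=> s Ss; split; first exact: SA.
  by move=> k k'; apply: Sf; left.
by move=> k k'; apply: Sf; right; rewrite invgK.
Qed.

Hypothesis Bfactors : forall b, B b -> factors (psi b).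

Definition locals g : Prop := B g /\ supported W g.

(** If d = l k with l trivial on [W], then l commutes with the
    conjugate, which is supported in [W], so only k matters. *)
Lemma conj_factor d g : B d -> B g -> supported W (d * g * d^-1) ->
  exists2 k, K k & psi (d * g * d^-1) = k * psi g * k^-1.
Proof.
move=> Bd Bg Wdg; have [l [k [Al fl Kk dE]]] := Bfactors Bd.
exists k => //.
have Ad := BA Bd; have Ag := BA Bg.
have Adg : A (d * g * d^-1) by do ?[apply: AM | apply: AV].
have -> : d * g * d^-1 = l^-1 * (d * g * d^-1) * l.
  by rewrite -(mulgA l^-1) -(fixes_supported_commute fl Wdg) mulKg.
rewrite psiM //; last by apply: AM => //; exact: AV.
rewrite psiM //; last exact: AV.
rewrite (psiM _ (AV Ad)); last exact: AM.
rewrite psiM // !psiV // dE invgM.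
by rewrite !mulgA mulVg mul1g mulgVK.
Qed.


Section Absorb.
Variable N : set G.
Hypothesis sN : is_subgroup N.
Hypothesis nbhsN : nbhs 1 N.
Hypothesis normN : forall k g, K k -> N g -> N (k * g * k^-1).
Hypothesis cK : compact K.
Hypothesis oW : open W.

(** The elements of [B] supported in [W] whose image lies in the small
    subgroup [N].  They form a normal subgroup of the elements of [B] supported
    in [W], by [conj_factor]. *)
Definition small_locals g : Prop := locals g /\ N (psi g).

Let locals_subgroup : is_subgroup locals.
Proof.
have [s1 sM sV] := supported_subgroup W.
split=> [|g h [Bg sg] [Bh sh]|g [Bg sg]].
- by split.
- by split; [exact: BM|exact: sM].
- by split; [exact: BV|exact: sV].
Qed.

Let small_locals_subgroup : is_subgroup small_locals.
Proof.
have [D1 DM DV] := locals_subgroup; have [N1 NM NV] := sN.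
split=> [|g h [Dg Ng] [Dh Nh]|g [Dg Ng]]; first by rewrite /small_locals psi1.
  split; first exact: DM.
  by rewrite psiM; [exact: NM|exact: BA Dg.1|exact: BA Dh.1].
by split; [exact: DV|rewrite psiV; [exact: NV|exact: BA Dg.1]].
Qed.

Let locals_conj d f : locals d -> locals f -> locals (d * f * d^-1).
Proof.
have [D1 DM DV] := locals_subgroup => Dd Df.
exact: DM _ _ (DM _ _ Dd Df) (DV _ Dd).
Qed.

Let small_locals_conj d f :
  locals d -> small_locals f -> small_locals (d * f * d^-1).
Proof.
move=> Dd [Df Nf].
have Ddf := locals_conj Dd Df.
split=> //; have [k Kk ->] := conj_factor Dd.1 Df.1 Ddf.2.
exact: normN.
Qed.

Variables (C : set X) (b c : L).
Hypothesis cC : clopen C.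
Hypothesis f3 : floors3 act C 1 b c.
Hypothesis CW : forall y, C y -> [/\ W y, W (act b y) & W (act c y)].
Let c0 := cyc3 act C 1 b c.
Hypothesis Bc0 : B c0.
Let W' := W `&`
  ~` (translate act 1 C `|` translate act b C `|` translate act c C).
Hypothesis W'0 : W' !=set0.

(** Conjugates c_k of c0 that send its letter c to many different letters
    k fall into finitely many cosets of [N], so c_i c_j^-1 is in [N] for some
    i <> j.  A cycle r over [U] that involves the letter i and commutes with c_j
    has the same commutator with c_i as with c_i c_j^-1.  Conjugating back, a
    cycle over [U] with two letters of c0 lies in [N], and [cyc3_split]
    concludes. *)
Lemma absorb_near x : C x -> exists V, [/\ clopen V, V x &
  forall U, clopen U -> U `<=` V -> U `<=` C ->
    small_locals (cyc3 act U 1 b c)].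
Proof.
move=> Cx; have [D1 DM DV] := locals_subgroup.
have [F1 FM FV] := small_locals_subgroup.
have [N1 NM NV] := sN.
have oW' : open W'.
  apply: openI => //; apply: closed_openC.
  have ct l : closed (translate act l C).
    by have [] := translate_clopen act l cC.
  by do ?apply: closedU.
have W'W y : W' y -> W y by case.
have W'off y u : W' y -> C u -> [/\ y <> u, y <> act b u & y <> act c u].
  move=> [_ nC] Cu; split=> yu; apply: nC; rewrite yu.
  - by left; left; rewrite translate1.
  - by left; right; rewrite translateE.
  - by right; rewrite translateE.
have Dc0 : locals c0.
  split=> //; apply: cyc3_supported => // y /CW[]; by rewrite ?act_one.
have c0W' y : W' y -> c0 y = y.
  move=> W'y; have [_ _ _ off] := cyc3P cC f3.
  apply: off => u Cu /esym; rewrite ?act_one.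
  - by have [] := W'off y u W'y Cu.
  - by have [] := W'off y u W'y Cu.
  - by have [] := W'off y u W'y Cu.
have [s sP] := compact_finite_cosets (compact_conj (g := psi c0) cK) nbhsN.
pose y := act c x.
have [z' [W'z' _ yz' tok]] := S_pairs y [::] oW' W'0.
have [ks0 [sks uks ksP]] := many_tokens (size s).+2 oW' W'0 yz' tok.
case: ks0 => [//|p' ks'] in sks uks ksP *.
have W'y : ~ W' y by move=> W'y; have [_ _] := W'off y x W'y Cx.
(* The letters were found at the base point y = cx; they are rebased at x. *)
pose z := z' * c; pose p := p' * c; pose ks := [seq k * c | k <- ks'].
have act_c m : act (m * c) x = act m y by rewrite act_mul.
have good m : m \in p :: ks -> W' (act m x) /\ good3 act B x c z m.
  rewrite -[p :: ks]/([seq k * c | k <- p' :: ks']) => /mapP[m' m'in ->].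
  have [W'm gm] := ksP m' m'in; rewrite act_c; split=> //.
  by have := good3_translate gm; rewrite mul1g.
have uks2 : uniq (act c x :: act z x :: act p x :: [seq act k x | k <- ks]).
  rewrite -map_comp (eq_map (g := fun k => act k y)); last first.
    by move=> k; exact: act_c.
  by rewrite !act_c.
have W'z : W' (act z x) by rewrite act_c.
pose F := [:: 1, b, c, z, p & ks].
have nW' v m : W' v -> m \in [:: 1; b; c] -> v != act m x.
  move=> W'v; have [v1 vb vc] := W'off v x W'v Cx.
  by rewrite !inE => /or3P[]/eqP->; rewrite ?act_one; apply/eqP.
have uF : uniq [seq act f x | f <- F].
  have W'F m : m \in [:: z, p & ks] -> W' (act m x).
    by rewrite inE => /predU1P[->//|/good[]].
  rewrite -[F]/([:: 1; b; c] ++ [:: z, p & ks]) map_cat cat_uniq.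
  apply/and3P; split; last by have /andP[] := uks2.
    move: f3 => [[o1 [o2 _]] [[o3 _] _]].
    rewrite /= !inE !negb_or; apply/and3P; split=> //.
      2: by apply/eqP; exact: o3.
    by apply/andP; split; apply/eqP; [exact: o1|exact: o2].
  apply/hasPn => _ /mapP[m /W'F W'm ->]; apply/mapP => -[m' m'F].
  by apply/eqP; exact: nW'.
pose Q m (V : set X) := (forall v, V v -> W' (act m v)) /\
  forall U, clopen U -> U `<=` V -> B (cyc3 act U c z m).
have [||V1 nV1 V1Q] := @nbhs_all X L x (p :: ks) Q.
- move=> m V V' VV [W'V BVm]; split=> [v /VV/W'V//|U cU UV].
  by apply: BVm => //; exact: subset_trans VV.
- move=> m /good[W'm [V [cV Vx _ BVm]]].
  exists (V `&` act m @^-1` W').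
    apply: filterI; first by apply: open_nbhs_nbhs; split=> //; exact: cV.1.
    by apply: (@homeo_continuous _ (act m)); exact: open_nbhs_nbhs.
  split=> [v []//|U cU UV]; apply: BVm => // v /UV[] //.
have nU : nbhs x (C `&` (V1 `&` act z @^-1` W')).
  apply: filterI; first by apply: open_nbhs_nbhs; split=> //; exact: cC.1.
  apply: filterI => //.
  by apply: (@homeo_continuous _ (act z)); exact: open_nbhs_nbhs.
have [V [cV Vx VU dV]] := floors_apart_nbhs hX nU uF.
have VC : V `<=` C by move=> v /VU[].
have VW' m v : m \in [:: z, p & ks] -> V v -> W' (act m v).
  rewrite inE => /predU1P[->|/V1Q[h _]] /VU[_ [V1v //]].
  by move=> _; exact: h.
have Bm m U : m \in p :: ks -> clopen U -> U `<=` V -> B (cyc3 act U c z m).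
  by move=> /V1Q[_ h] cU UV; apply: h => // v /UV/VU[_ []].
have ufl := map_uniq uF.
have f3m m U : m \in p :: ks -> U `<=` V -> floors3 act U c z m.
  move=> mF UV; apply: (floors_apart_floors3 (floors_apart_sub UV dV)).
  - move: ufl; rewrite -[F]/([:: 1; b] ++ [:: c, z, p & ks]) cat_uniq.
    move=> /and3P[_ _]; rewrite /= inE negb_or => /andP[/andP[cz]].
    move=> cm /andP[zm _]; rewrite /= !inE negb_or cz /= andbT.
    by apply/andP; split; [apply: contraNneq cm|apply: contraNneq zm] => ->.
  - by rewrite !inE eqxx ?orbT.
  - by rewrite !inE eqxx ?orbT.
  - by rewrite -[F]/([:: 1; b; c; z] ++ (p :: ks)) mem_cat mF orbT.
have DWm m U : m \in p :: ks -> clopen U -> U `<=` V ->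
    locals (cyc3 act U c z m).
  move=> mF cU UV; split; first exact: Bm.
  apply: cyc3_supported => //; first exact: f3m.
  - by move=> v /UV/VC/CW[].
  - by move=> v /UV vV; apply: W'W; apply: VW' => //; rewrite inE eqxx.
  - by move=> v /UV vV; apply: W'W; apply: VW' => //; rewrite inE mF orbT.
have DWm_rev m U : m \in p :: ks -> clopen U -> U `<=` V ->
    locals (cyc3 act U c m z).
  move=> mF cU UV; rewrite -(invgK (cyc3 act U c m z)) cyc3_inv //.
    by apply: DV; exact: DWm.
  by apply: floors3_rev; exact: f3m.
pose d k := cyc3 act V c k z.
have ksF k : k \in ks -> k \in p :: ks by rewrite inE orbC => ->.
(* The conjugates of c0 by the d k are conjugates by elements of K in G, so
   they meet only finitely many cosets of N. *)
have coset k : exists t : G, k \in ks ->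
    t \in s /\ N (psi (d k * c0 * (d k)^-1) * t^-1).
  have [kF|] := boolP (k \in ks); last by exists 1.
  have Dd : locals (d k) by apply: DWm_rev => //; exact: ksF.
  have Dc : locals (d k * c0 * (d k)^-1) by exact: locals_conj.
  have [kk Kkk E] := conj_factor Dd.1 Bc0 Dc.2.
  have [|t ts Nt] := sP (psi (d k * c0 * (d k)^-1)).
    by exists kk => //; rewrite E.
  by exists t.
have [f fP] := choice coset.
have uks3 : uniq ks by move: ufl; rewrite /F /= => /and5P[_ _ _ _ /andP[]].
have [|k kF|i [j [iks jks ij fij]]] := @pigeonhole _ _ f ks s uks3.
- by move: sks; rewrite /ks size_map /= => -[->].
- by have [] := fP k kF.
pose ck k := d k * c0 * (d k)^-1.
have Dck k : k \in ks -> locals (ck k).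
  by move=> kF; apply: locals_conj => //; apply: DWm_rev => //; exact: ksF.
have Fij : small_locals (ck i * (ck j)^-1).
  split; first by apply: DM; [exact: Dck|apply: DV; exact: Dck].
  rewrite psiM; last 2 first.
  - exact: BA (Dck i iks).1.
  - by apply: AV; exact: BA (Dck j jks).1.
  rewrite psiV; last exact: BA (Dck j jks).1.
  have [_ Ni] := fP i iks; have [_ Nj] := fP j jks.
  have -> : psi (ck i) * (psi (ck j))^-1 =
      (psi (ck i) * (f i)^-1) * (psi (ck j) * (f j)^-1)^-1.
    by rewrite fij invgM invgK !mulgA mulgVK.
  by apply: NM => //; exact: NV.
exists V; split=> // U cU UV UC.
pose r' := cyc3 act U c p z.
have Dr' : locals r' by apply: DWm_rev => //; rewrite inE eqxx.
pose r := d i * r' * (d i)^-1.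
have Ddi : locals (d i) by apply: DWm_rev => //; exact: ksF.
have Dr : locals r by exact: locals_conj.
have sub5 : {subset [:: c; z; p; i; j] <= F}.
  move=> m; rewrite /F !inE => /or4P[/eqP->|/eqP->|/eqP->|/orP[]/eqP->];
  by rewrite ?eqxx ?iks ?jks ?orbT.
have u5 : uniq [:: c; z; p; i; j].
  move: ufl; rewrite /F /= !inE !negb_or.
  move=> /and5P[_ _ /and3P[-> cp cks] /andP[zp zks] /andP[pks _]].
  have ne t k : k \in ks -> t \notin ks -> t != k.
    by move=> kF; apply: contraNneq => ->.
  by rewrite cp zp ij !ne.
have comm : ck j * r = r * ck j.
  apply: (@conj_commute U V c z p i j c0) => //.
    by move=> m m' mF m'F; apply: dV; exact: sub5.
  move=> m mF v Vv; apply: c0W'; apply: VW' => //.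
  by move: mF; rewrite !inE => /or4P[]/eqP->; rewrite ?eqxx ?iks ?jks ?orbT.
(* This is also the commutator of c_i c_j^-1 with r, as c_j commutes with r. *)
have Fcr : small_locals (ck i * r * (ck i)^-1 * r^-1).
  have -> : ck i * r * (ck i)^-1 * r^-1 =
      (ck i * (ck j)^-1) * (r * (ck i * (ck j)^-1)^-1 * r^-1).
    exact: commutator_quotient comm.
  apply: FM => //; apply: small_locals_conj => //; exact: FV.
have Fc0r : small_locals (c0 * r' * c0^-1 * r'^-1).
  have -> : c0 * r' * c0^-1 * r'^-1 =
      (d i)^-1 * (ck i * r * (ck i)^-1 * r^-1) * (d i)^-1^-1.
    exact: commutator_conj.
  by apply: small_locals_conj => //; exact: DV.
have [z1 p1] : z \in [:: z, p & ks] /\ p \in [:: z, p & ks].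
  by rewrite !inE !eqxx orbT.
have off m y1 u1 n : m \in [:: z; p] -> n \in [:: 1; b; c] -> U y1 -> C u1 ->
    act n u1 <> act m y1.
  move=> mF nF /UV Vy1 Cu1 E.
  have W'm : W' (act m y1).
    apply: VW' => //; move: mF.
    by rewrite !inE => /orP[]/eqP->; rewrite eqxx ?orbT.
  have [e1 e2 e3] := W'off _ _ W'm Cu1.
  move: nF E; rewrite !inE => /or3P[]/eqP-> /esym //.
  by rewrite act_one.
have dzp : apart act (p, U) (z, U).
  apply: (apart_sub (dV p z _ _ _)) => //; first by rewrite !inE eqxx ?orbT.
    by rewrite !inE eqxx ?orbT.
  rewrite eq_sym; move: u5; rewrite /= !inE !negb_or.
  by move=> /and5P[_ /and3P[-> _ _] _ _ _].
have Fs : small_locals (cyc3 act U 1 p c).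
  rewrite -(setIidr UC) -(@cyc3_commutator _ _ act C U 1 b c p z) //.
  have CUC : C `|` U `<=` C by move=> v [|/UC].
  move: f3 => [[o1 [o2 _]] [[o3 _] _]].
  do ?split=> //.
  - exact: (apart_sub o2).
  - by move=> y1 u1 /= Cy1 Uu1; apply: off => //; rewrite !inE eqxx ?orbT.
  - by move=> y1 u1 /= Cy1 Uu1; apply: off => //; rewrite !inE eqxx ?orbT.
  - exact: (apart_sub o3).
  - by move=> y1 u1 /= Cy1 Uu1; apply: off => //; rewrite !inE eqxx ?orbT.
  - by move=> y1 u1 /= Cy1 Uu1; apply: off => //; rewrite !inE eqxx ?orbT.
  - by move=> y1 u1 /= /CUC Cy1 Uu1; apply: off => //; rewrite !inE eqxx ?orbT.
  - by move=> y1 u1 /= /CUC Cy1 Uu1; apply: off => //; rewrite !inE eqxx ?orbT.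
have Es := @cyc3_split _ _ act C U 1 b c p cC cU UC _.
rewrite (_ : cyc3 act U 1 b c =
  cyc3 act U 1 p c * (c0 * cyc3 act U 1 p c * c0^-1)); last first.
  apply: (@mulIg _ c0); rewrite -Es ?mulgA ?mulgVK //.
  move: f3 => [[o1 [o2 _]] [[o3 _] _]].
  do ?split=> //;
    by move=> y1 u1 /= Cy1 Uu1; apply: off => //; rewrite !inE eqxx ?orbT.
by apply: FM => //; apply: small_locals_conj.
Qed.

(** The cycle c0 is a product of its restrictions to small clopen sets. *)
Lemma absorb : small_locals c0.
Proof.
have [F1 FM FV] := small_locals_subgroup; have [cX _ _ _] := hX.
pose P U := U `<=` C -> small_locals (cyc3 act U 1 b c).
suff /(_ (@subset_refl _ C)) : P C by [].
apply: (@clopen_ind X cX P) => //; rewrite /P.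
- by rewrite cyc3_set0.
- move=> U V cU cV UV FU FV' UVC.
  rewrite cyc3_setU //; last exact: floors3_sub UVC f3.
  by apply: FM; [apply: FU|apply: FV'] => v Uv; apply: UVC; [left|right].
- move=> x /absorb_near[V [cV Vx FV']]; exists V.
  by split=> // U cU UV; exact: FV'.
Qed.

End Absorb.
End Factor.

(** Otherwise the group [B] would be contained in F K, with F the elements
    trivial on [W]; then [absorb], applied to a subgroup [N] that misses the
    image of some cycle supported in [W], gives a contradiction. *)
Lemma no_cover (K T : set G) (W : set X) : is_subgroup K -> compact K ->
  open W -> W !=set0 ->
  (forall s k k', S s \/ S s^-1 -> K k -> K k' ->
     exists2 t, T t & K (t^-1 * (k * psi s * k'))) ->
  ~ (forall t, T t -> exists a, [/\ A a, fixes W a & K (t^-1 * psi a)]).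
Proof.
move=> sK cK oW [x Wx] TP Tfix; have [K1 KM KV] := sK.
have Bf b : B b -> factors K W (psi b).
  apply: generated_factors => // s k k' Ss Kk Kk'.
  have [t Tt Kt] := TP s k k' Ss Kk Kk'; have [a [Aa fa Ka]] := Tfix t Tt.
  exists a, ((psi a)^-1 * (k * psi s * k')); split=> //; last first.
    by rewrite mulVKg.
  have -> : (psi a)^-1 * (k * psi s * k') =
      (t^-1 * psi a)^-1 * (t^-1 * (k * psi s * k')).
    by rewrite invgM invgK -(mulgA (psi a)^-1) mulVKg.
  by apply: KM => //; exact: KV.
have [b [Wb _ xb tok]] := S_pairs x [::] oW (ex_intro _ x Wx).
have [l [Wl]] := orbit_avoid hX x [:: x; act b x] minX oW (ex_intro _ x Wx).
move=> /tok[c cl [V [cV Vx f3V BV3]]].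
have Wc : W (act c x) by rewrite cl.
(* A fourth point of the orbit in W leaves room outside of the floors of c0. *)
have [m [Wm mx]] := orbit_avoid hX x [:: x; act b x; act c x] minX oW
  (ex_intro _ x Wx).
have u4 : uniq [seq act f x | f <- [:: 1; b; c; m]].
  move: mx; move: f3V => [[o1 [o2 _]] [[o3 _] _]].
  rewrite /= !inE !negb_or act_one ![act m x == _]eq_sym => /and3P[-> -> ->].
  rewrite !andbT xb /=; apply/andP; split.
    by apply/eqP; have := o2 x x Vx Vx; rewrite /= act_one.
  by apply/eqP; exact: o3.
have nb f : W (act f x) -> nbhs x (act f @^-1` W).
  move=> Wf; apply: (@homeo_continuous _ (act f)); exact: open_nbhs_nbhs.
have nW : nbhs x W by exact: open_nbhs_nbhs.
have nV : nbhs x V by apply: open_nbhs_nbhs; split=> //; exact: cV.1.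
have [C [cC Cx CU dC]] := floors_apart_nbhs hX
  (filterI nV (filterI nW (filterI (nb b Wb) (nb c Wc)))) u4.
have CV : C `<=` V by move=> y /CU[].
have CW y : C y -> [/\ W y, W (act b y) & W (act c y)].
  by move=> /CU[_ [? [? ?]]].
have f3C := floors3_sub CV f3V.
pose c0 := cyc3 act C 1 b c.
have Bc0 : B c0 by exact: BV3.
have c0x : c0 x = act b x.
  by have [c1 _ _ _] := cyc3P cC f3C; have := c1 x Cx; rewrite act_one.
have psic0 : psi c0 <> 1.
  move=> /(psi_inj (BA Bc0)) c01; move: xb; rewrite -c0x c01.
  by rewrite homeo1E eqxx.
have nO : nbhs 1 (~` [set psi c0]).
  apply: open_nbhs_nbhs; split; last by move=> /= /esym.
  apply: closed_openC; apply: accessible_closed_set1.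
  exact/hausdorff_accessible/tdlc_hausdorff.
have [N [sN nN NO normN]] := small_normal_subgroup tdlcG sK cK nO.
have [|_ /NO] := @absorb K W Bf N sN nN normN cK oW C b c cC f3C CW Bc0.
  exists (act m x); split=> //.
  have mC f : f \in [:: 1; b; c] -> ~ translate act f C (act m x).
    move=> fF Cf; have fm : f != m.
      have /= : uniq [:: 1; b; c; m] by exact: map_uniq u4.
      rewrite !inE !negb_or => /and4P[/and3P[_ _ m1] /andP[_ mb] mc _].
      by move: fF; rewrite !inE => /or3P[]/eqP->.
    have fF4 : f \in [:: 1; b; c; m].
      by rewrite -[[:: 1; b; c; m]]/([:: 1; b; c] ++ [:: m]) mem_cat fF.
    have mF4 : m \in [:: 1; b; c; m] by rewrite !inE eqxx !orbT.
    by apply: (dC f m fF4 mF4 fm _ _ Cf Cx); rewrite /= act_invr.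
  by move=> [[|]|]; apply: mC; rewrite !inE eqxx ?orbT.
by apply.
Qed.

End NoCover.

(** * Separating points by small elements *)

Section Separation.
Variables (L : groupType) (X : topologicalType).
Variable act : group_hom L (homeo X).
Hypothesis hX : cantor_axioms X.
Hypothesis minX : minimal_action act.
Local Notation A := (alternating_full_group act).
Variable G : topGroupType.
Hypothesis tdlcG : tdlc G.
Variable psi : homeo X -> G.
Hypothesis psiM : forall g h, A g -> A h -> psi (g * h) = psi g * psi h.
Hypothesis psi_inj : forall g, A g -> psi g = 1 -> g = 1.
Hypothesis psi_dense : forall (g : G) O, nbhs g O -> exists2 a, A a & O (psi a).

Let sA : is_subgroup A. Proof. exact: is_subgroup_generated. Qed.
Let A1 : A 1. Proof. by have [] := sA. Qed.
Let AM g h : A g -> A h -> A (g * h).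
Proof. by have [_ AM _] := sA; exact: AM. Qed.
Let AV g : A g -> A g^-1.
Proof. by have [_ _ AV] := sA; exact: AV. Qed.

Variable S : set (homeo X).
Hypothesis finS : finite_set S.
Hypothesis SA : S `<=` A.
Local Notation B := (generated_subgroup S).
Hypothesis S_pairs : forall x (U : set X) (s : seq X), open U -> U !=set0 ->
  exists a, [/\ U (act a x), act a x \notin s, x != act a x &
    forall l, act l x \notin [:: x; act a x] -> token act B x 1 a (act l x)].

(** Right cosets of inverses are left cosets, and multiplying by K on
    the right does not change a left coset of K. *)
Lemma finite_double_cosets (K : set G) : is_subgroup K -> compact K ->
  nbhs 1 K -> exists T : set G, finite_set T /\
    forall s k k', S s \/ S s^-1 -> K k -> K k' ->
      exists2 t, T t & K (t^-1 * (k * psi s * k')).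
Proof.
move=> [K1 KM KV] cK nK; pose S' := S `|` (fun s => s^-1) @` S.
have cKs g : compact [set (k * g)^-1 | k in K].
  apply: (@continuous_compact _ _ (fun k => (k * g)^-1)) => //.
  apply: continuous_subspaceT => k U /nbhs_inv nU.
  exact: nbhs_mulr nU.
have [f fP] := choice (fun g => compact_finite_cosets (cKs g) nK).
exists (\bigcup_(s in S') [set` [seq t^-1 | t <- f (psi s)]]); split.
  apply: bigcup_finite => [|s _]; last exact: finite_seq.
  by rewrite finite_setU; split=> //; exact: finite_image.
move=> s k k' Ss Kk Kk'.
have [|t tf Kt] := fP (psi s) (k * psi s)^-1; first by exists k.
exists t^-1.
  exists s; last by rewrite /= map_f.
  by case: Ss => [|Ss]; [left|right; exists s^-1; rewrite ?invgK].
have := KV _ Kt; rewrite invgM !invgK => Kt'.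
by rewrite mulgA; apply: KM.
Qed.

(** Otherwise one can shrink an open set finitely many times, once for
    each of the cosets covering K S K, and contradict [no_cover]. *)
Lemma moving_coset (K : set G) (x0 : X) : is_subgroup K -> compact K ->
  nbhs 1 K -> exists (t : G) (V : set X), [/\ open V, V !=set0 &
    forall a V', A a -> K (t^-1 * psi a) -> open V' -> V' `<=` V ->
      V' !=set0 -> ~ fixes V' a].
Proof.
move=> sK cK nK; apply: contrapT => nomove.
have fixsome t V : open V -> V !=set0 -> exists a V', [/\ A a,
    K (t^-1 * psi a), open V' & [/\ V' `<=` V, V' !=set0 & fixes V' a]].
  move=> oV V0; apply: contrapT => nfix; apply: nomove.
  exists t, V; split=> // a V' Aa Ka oV' V'V V'0 fa; apply: nfix.
  by exists a, V'.
have [T [/finite_seqP[l lE] TP]] := finite_double_cosets sK cK nK.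
suff [W [oW W0 Wfix]] : exists W, [/\ open W, W !=set0 & forall t, t \in l ->
    exists a, [/\ A a, fixes W a & K (t^-1 * psi a)]].
  apply: (@no_cover _ _ _ hX minX _ tdlcG psi psiM psi_inj S SA S_pairs K T W)
    => // t.
  by rewrite lE => /Wfix.
elim: (l) => [|t l' [W [oW W0 Wfix]]].
  by exists [set: X]; split=> //; [exact: openT|exists x0].
have [a [V' [Aa Ka oV' [V'W V'0 fa]]]] := fixsome t W oW W0.
exists V'; split=> // u; rewrite inE => /predU1P[->|/Wfix[b [Ab fb Kb]]].
  by exists a.
by exists b; split=> // x /V'W; exact: fb.
Qed.

Definition separated_by_nbhs (x y : X) : Prop := exists U V O,
  [/\ nbhs x U, nbhs y V, nbhs (1 : G) O &
    forall a z, A a -> O (psi a) -> U z -> ~ V (a z)].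

Lemma nbhs_act (l : L) (x : X) (U : set X) :
  nbhs (act l x) U -> nbhs x (act l @^-1` U).
Proof. exact: (@homeo_continuous _ (act l)). Qed.

Lemma move_point (x y : X) (U : set X) : x != y -> open U -> U !=set0 ->
  exists b : homeo X, [/\ A b, U (b x) & b y = y].
Proof.
move=> xy oU U0; have [_ hausX _ _] := hX.
have [l [Ul]] := orbit_avoid hX x [:: x; y] minX oU U0.
rewrite !inE !negb_or => /andP[lx ly].
have [m [_]] := orbit_avoid hX x [:: x; y; act l x] minX openT
  (ex_intro _ x I : [set: X] !=set0).
rewrite !inE !negb_or => /and3P[mx my ml].
have u3 : uniq [seq act f x | f <- [:: 1; l; m]].
  by rewrite /= !inE !negb_or act_one eq_sym lx eq_sym mx eq_sym ml.
have ny z : z != y -> nbhs z (~` [set y]).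
  move=> zy; apply: open_nbhs_nbhs; split; last exact/eqP.
  by apply/closed_openC/accessible_closed_set1/hausdorff_accessible.
have [C [cC Cx CU dC]] := floors_apart_nbhs hX (filterI (ny x xy)
  (filterI (nbhs_act (ny _ ly)) (nbhs_act (ny _ my)))) u3.
have f3 : floors3 act C 1 l m.
  by apply: floors_apart_floors3 dC _ _ _ _; rewrite ?inE ?eqxx ?orbT //;
    exact: map_uniq u3.
have [c1 _ _ off] := cyc3P cC f3.
exists (cyc3 act C 1 l m); split; first exact: cyc3_alternating.
  by have := c1 x Cx; rewrite act_one => ->.
by apply: off => z /CU[zy [lz mz]]; rewrite ?act_one.
Qed.

(** Conjugating by an element of A that carries x into [U] and y into
    [V] transports the failure of separation. *)
Lemma not_separated_transitive (x y : X) : x != y ->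
  ~ separated_by_nbhs x y ->
  forall (U V : set X) (O : set G), open U -> U !=set0 -> open V ->
    V !=set0 -> nbhs 1 O ->
    exists a z, [/\ A a, O (psi a), U z & V (a z)].
Proof.
move=> xy nsep U V O oU U0 oV V0 nO.
have [b1 [Ab1 Ub1 b1y]] := move_point xy oU U0.
have yb1 : y != b1 x.
  by apply: contra_neq xy => yb; apply: (@homeo_inj _ b1); rewrite b1y.
have [b2 [Ab2 Vb2 b2x]] := move_point yb1 oV V0.
pose b := b2 * b1; have Ab : A b by exact: AM.
have bx : b x = b1 x by rewrite homeoME b2x.
have by' : b y = b2 y by rewrite homeoME b1y.
apply: contrapT => none; apply: nsep.
exists (b @^-1` U), (b @^-1` V), [set g | O (psi b * g * (psi b)^-1)]; split.
- by apply: (@homeo_continuous _ b); apply: open_nbhs_nbhs; rewrite bx.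
- by apply: (@homeo_continuous _ b); apply: open_nbhs_nbhs; rewrite by'.
- have nO' : nbhs (psi b * 1 * (psi b)^-1) O by rewrite mulg1 mulgV.
  exact: nbhs_mull (nbhs_mulr nO').
- move=> a z Aa Oa Uz Vz; apply: none; exists (b * a * b^-1), (b z).
  split=> //; first exact: AM (AM Ab Aa) (AV Ab).
    by rewrite (psiM (AM Ab Aa) (AV Ab)) (psiM Ab Aa) (psiV psiM Ab).
  by rewrite !homeoME homeoVE homeoK.
Qed.

(** The commutator argument described at the top, with g^-1 = h0 a
    cycle that agrees with a0^-1 near the point z. *)
Lemma points_separated (x y : X) : x <> y -> separated_by_nbhs x y.
Proof.
move=> /eqP xy; apply: contrapT => nsep.
have trans := not_separated_transitive xy nsep.
have [K [sK cK nK _]] := van_dantzig tdlcG (@filterT _ (nbhs (1 : G)) _).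
have [K1 KM KV] := sK.
have [t [V [oV V0 move_t]]] := moving_coset x sK cK nK.
have [a0 Aa0 Ka0] := psi_dense (nbhs1_translatel t nK).
have [z Vz az] : exists2 z, V z & a0^-1 z <> z.
  apply: contrapT => nz; apply: (move_t a0 V Aa0 Ka0 oV _ V0) => // z Vz.
  have az : a0^-1 z = z by apply: contrapT => az; apply: nz; exists z.
  by rewrite -[in LHS]az homeoVE homeo_invK.
have [l nl] := alternating_full_group_sub (AV Aa0) z.
have lz : act l z != z.
  by apply/eqP; have := nbhs_singleton nl; rewrite /= => <-.
have [m [_]] := orbit_avoid hX z [:: z; act l z] minX openT
  (ex_intro _ z I : [set: X] !=set0).
rewrite !inE !negb_or => /andP[mz ml].
have [n [_]] := orbit_avoid hX z [:: z; act l z; act m z] minX openT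
  (ex_intro _ z I : [set: X] !=set0).
rewrite !inE !negb_or => /and3P[nz nl' nm].
have u4 : uniq [seq act f z | f <- [:: 1; l; m; n]].
  by rewrite /= !inE !negb_or act_one ![_ == act n z]eq_sym
    ![_ == act m z]eq_sym [z == _]eq_sym lz mz ml [_ == act n z]eq_sym
    nz nl' nm.
have nV : nbhs z V by exact: open_nbhs_nbhs.
have [C [cC Cz CU dC]] := floors_apart_nbhs hX (filterI nV nl) u4.
have [i1 il im jn] : [/\ 1 \in [:: 1; l; m; n], l \in [:: 1; l; m; n],
  m \in [:: 1; l; m; n] & n \in [:: 1; l; m; n]].
  by split; rewrite !inE eqxx ?orbT.
have ufl := map_uniq u4.
(* The fourth letter n only provides room on which the cycle is trivial. *)
have f3 : floors3 act C 1 l m.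
  apply: floors_apart_floors3 dC _ i1 il im; move: ufl; rewrite /= !inE !negb_or.
  by move=> /and4P[/and3P[-> -> _] /andP[-> _] _ _].
have [c1 cl cm coff] := cyc3P cC f3.
pose h0 := cyc3 act C 1 l m.
have Ah0 : A h0 by exact: cyc3_alternating.
pose g := h0^-1; have Ag : A g by exact: AV.
pose Y := translate act n C.
have oY : open Y by have [] := translate_clopen act n cC.
have Y0 : Y !=set0 by exists (act n z); rewrite /Y translateE.
have gY u : Y u -> g u = u.
  move=> Yu; have h0u : h0 u = u.
    move: ufl; rewrite /= !inE !negb_or.
    move=> /and4P[/and3P[_ _ n1] /andP[_ n2] n3 _].
    by apply: coff => v Cv vu;
      [apply: (dC 1 n i1 jn n1 v _ Cv Yu)|apply: (dC l n il jn n2 v _ Cv Yu)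
      |apply: (dC m n im jn n3 v _ Cv Yu)]; rewrite /= act_invr.
  by rewrite -[in LHS]h0u /g homeoVE homeoK.
pose O := [set k : G | K (k * psi g * k^-1 * (psi g)^-1)].
have nO : nbhs 1 O.
  have nK1 : nbhs (1 * psi g * 1^-1 * (psi g)^-1) K.
    by rewrite invg1 mulg1 mul1g mulgV.
  have [M [M' [nM /nbhs_inv nM' MM]]] := nbhs_mul (nbhs_mulr nK1).
  by apply: filterS (filterI (nbhs_mulr nM) nM') => k [Mk M'k]; exact: MM.
have olC : open (translate act l C) by have [] := translate_clopen act l cC.
have lC0 : translate act l C !=set0 by exists (act l z); rewrite translateE.
have [h [u [Ah Oh Yu hu]]] := trans _ _ _ oY Y0 olC lC0 nO.
(* On V' this commutator acts as g^-1, hence as a0^-1. *)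
pose h' := h * g * h^-1 * g^-1.
have Ahg : A (h * g * h^-1) by exact: AM (AM Ah Ag) (AV Ah).
have Ah' : A h' by exact: AM Ahg (AV Ag).
pose V' := C `&` [set v | Y (homeo_inv h (act l v))].
have V'V : V' `<=` V by move=> v [/CU[]].
apply: (move_t (a0 * h') V' (AM Aa0 Ah') _ _ V'V).
- rewrite psiM // mulgA; apply: KM => //.
  by rewrite (psiM Ahg (AV Ag)) (psiM (AM Ah Ag) (AV Ah)) (psiM Ah Ag)
    (psiV psiM Ag) (psiV psiM Ah).
- apply: openI; first exact: cC.1.
  apply: open_comp oY => v _; apply: continuous_comp.
    exact: homeo_continuous.
  exact: homeo_inv_continuous.
- exists (act l^-1 (h u)); split; first by [].
  by rewrite /= act_invr homeoK.
- move=> v [Cv Yv]; have [_ /= nv] := CU v Cv.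
  have h0v : h0 v = act l v by have := c1 v Cv; rewrite act_one.
  have gv : homeo_inv h0 (homeo_inv h (act l v)) = homeo_inv h (act l v).
    exact: gY Yv.
  change (a0 (h (homeo_inv h0 (homeo_inv h (h0 v)))) = v).
  by rewrite h0v gv homeo_invK -nv homeo_invK.
Qed.

(** Separate the points of [U] from those of its complement, and use
    compactness of both. *)
Lemma clopen_stable (U : set X) : clopen U ->
  exists2 O : set G, nbhs 1 O &
    forall a z, A a -> O (psi a) -> U z -> U (a z).
Proof.
move=> [oU cU]; have [cX _ _ _] := hX.
have compU : compact U by exact: (subclosed_compact cU cX).
have compUC : compact (~` U).
  by apply: (subclosed_compact _ cX) => //; exact: open_closedC.
pose P (x : X) (g : G) := forall a, A a -> psi a = g -> U (a x).
have nP : nbhs (1 : G) [set g | forall x, U x -> P x g].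
  apply: (compact_tube compU) => x Ux.
  pose Q E := exists V O, [/\ nbhs x V, nbhs (1 : G) O &
    forall a z, A a -> O (psi a) -> V z -> ~ E (a z)].
  have [V [O [nV nO VO]]] : Q (~` U).
    apply: (@compact_ind X Q) => //.
    - exists [set: X], [set: G].
      by split=> [||a z _ _ _ []]; exact: filterT.
    - move=> E E' EE [V [O [nV nO VO]]]; exists V, O; split=> // a z Aa Oa Vz.
      by move=> /EE; exact: VO.
    - move=> E E' [V [O [nV nO VO]]] [V' [O' [nV' nO' VO']]].
      exists (V `&` V'), (O `&` O'); split; [exact: filterI|exact: filterI|].
      by move=> a z Aa [Oa O'a] [Vz V'z] [|]; [exact: VO|exact: VO'].
    - move=> y Uy; have [|V [E [O [nV nE nO VO]]]] := @points_separated x y.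
        by move=> xy; apply: Uy; rewrite -xy.
      by exists E => //; exists V, O.
  exists V, O; split=> // z g Vz Og a Aa ag; apply: contrapT => nU.
  by apply: (VO a z Aa _ Vz nU); rewrite ag.
exists [set g | forall x, U x -> P x g] => // a z Aa Pa Uz.
exact: Pa.
Qed.

End Separation.

(** * Extension of the action *)

Section Extension.
Variables (X : topologicalType) (G : topGroupType).
Hypothesis hX : cantor_axioms X.
Variable A : set (homeo X).
Hypothesis sA : is_subgroup A.
Variable psi : homeo X -> G.
Hypothesis psiM : forall g h, A g -> A h -> psi (g * h) = psi g * psi h.
Hypothesis psi_dense : forall (g : G) O, nbhs g O -> exists2 a, A a & O (psi a).
Hypothesis stable : forall U : set X, clopen U ->
  exists2 O : set G, nbhs 1 O &
    forall a z, A a -> O (psi a) -> U z -> U (a z).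

Let A1 : A 1. Proof. by have [] := sA. Qed.
Let AM g h : A g -> A h -> A (g * h).
Proof. by have [_ AM _] := sA; exact: AM. Qed.
Let AV g : A g -> A g^-1.
Proof. by have [_ _ AV] := sA; exact: AV. Qed.

Let psi_1 : psi 1 = 1.
Proof. by apply: (@mulgI _ (psi 1)); rewrite -psiM // !mulg1. Qed.

Let psi_V g : A g -> psi g^-1 = (psi g)^-1.
Proof.
by move=> Ag; apply/esym/mulg1_eq; rewrite -psiM ?mulgV ?psi_1 //; exact: AV.
Qed.

Definition limit_at (g : G) (x y : X) : Prop := forall V, nbhs y V ->
  exists2 O, nbhs g O & forall a, A a -> O (psi a) -> V (a x).

(** Two elements of A close to the same g differ by a small element. *)
Lemma stable_near (g : G) (V : set X) : clopen V -> exists2 O, nbhs g O &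
  forall a b z, A a -> A b -> O (psi a) -> O (psi b) -> V (a z) -> V (b z).
Proof.
move=> /stable[O nO OV].
have nO' : nbhs (g * g^-1) O by rewrite mulgV.
have [M [M' [nM /nbhs_inv nM' MM]]] := nbhs_mul nO'.
exists (M `&` [set x | M' x^-1]); first exact: filterI.
move=> a b z Aa Ab [_ M'a] [Mb _] Vaz.
have -> : b z = (b * a^-1) (a z) by rewrite homeoME homeoVE homeoK.
apply: OV => //; first by apply: AM => //; exact: AV.
by rewrite psiM ?psi_V //; [exact: MM|exact: AV].
Qed.

(** A cluster point of the images of [x] is a limit: by [stable_near] the
    images stay in each clopen set that they visit. *)
Lemma limit_exists g x : exists y, limit_at g x y.
Proof.
have [cX _ baseX _] := hX.
pose F := [set E | exists2 O, nbhs g O & forall a, A a -> O (psi a) -> E (a x)].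
have FF : ProperFilter F.
  split.
    move=> [O nO OE]; have [a Aa Oa] := psi_dense nO.
    exact: OE a Aa Oa.
  split.
  - by exists [set: G] => //; exact: filterT.
  - move=> E E' [O nO OE] [O' nO' OE']; exists (O `&` O'); first exact: filterI.
    by move=> a Aa [Oa O'a]; split; [exact: OE|exact: OE'].
  - by move=> E E' EE [O nO OE]; exists O => // a Aa /(OE a Aa)/EE.
have [|y [_ Fy]] := cX F FF; first exact: filterT.
exists y => W nW; have [V [cV Vy VW]] := baseX y W nW.
have [O nO OV] := stable_near g cV.
have FO : F [set a x | a in A `&` [set a | O (psi a)]].
  by exists O => // a Aa Oa; exists a.
have nV : nbhs y V by apply: open_nbhs_nbhs; split=> //; exact: cV.1.
have [_ [[a [Aa Oa] <-] Vax]] := Fy _ _ FO nV.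
by exists O => // b Ab Ob; apply: VW; exact: OV Aa Ab Oa Ob Vax.
Qed.

Lemma limit_unique g x y y' : limit_at g x y -> limit_at g x y' -> y = y'.
Proof.
move=> ly ly'; have [_ hausX _ _] := hX; apply: hausX => V V' nV nV'.
have [O nO OV] := ly V nV; have [O' nO' OV'] := ly' V' nV'.
have [a Aa [Oa O'a]] := psi_dense (filterI nO nO').
by exists (a x); split; [exact: OV|exact: OV'].
Qed.

Definition extension (g : G) (x : X) : X := projT1 (cid (limit_exists g x)).

Lemma extensionP g x : limit_at g x (extension g x).
Proof. exact: projT2 (cid (limit_exists g x)). Qed.

Lemma extension_psi a x : A a -> extension (psi a) x = a x.
Proof.
move=> Aa; apply: limit_unique (@extensionP (psi a) x) _ => W nW.
have [_ _ baseX _] := hX; have [V [cV Vy VW]] := baseX _ W nW.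
have [O nO OV] := stable_near (psi a) cV.
exists O => // b Ab Ob; apply: VW; apply: OV Aa Ab _ Ob Vy.
exact: nbhs_singleton.
Qed.

(** Joint continuity: a single element a of A near g controls all
    elements near g at once, on the preimage under a of a clopen set. *)
Lemma extension_nbhs g x W : nbhs (extension g x) W ->
  exists O N, [/\ nbhs g O, nbhs x N &
    forall g' x', O g' -> N x' -> W (extension g' x')].
Proof.
move=> nW; have [_ _ baseX _] := hX.
have [V [cV Vy VW]] := baseX _ W nW.
have nV : nbhs (extension g x) V.
  by apply: open_nbhs_nbhs; split=> //; exact: cV.1.
have [O nO OV] := stable_near g cV.
have [O' nO' OV'] := extensionP nV.
have [a Aa [Oa O'a]] := psi_dense (filterI nO nO').
exists (O°), (a @^-1` V); split.
- exact: nbhs_interior.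
- apply: (@homeo_continuous _ a); apply: open_nbhs_nbhs; split.
    exact: cV.1.
  exact: OV'.
- move=> g' x' Og' Vx'; apply: VW; apply: contrapT => nVg.
  have [|M nM MV] := @extensionP g' x' (~` V).
    by apply: open_nbhs_nbhs; split=> //; exact: closed_openC cV.2.
  have [b Ab [Mb Ob]] := psi_dense (filterI nM Og').
  by apply: (MV b Ab Mb); exact: OV Aa Ab Oa Ob Vx'.
Qed.

Lemma extension1 x : extension 1 x = x.
Proof. by rewrite -psi_1 extension_psi. Qed.

Lemma extensionM g h x : extension (g * h) x = extension g (extension h x).
Proof.
apply: limit_unique (@extensionP (g * h) x) _ => W nW.
have [O [N [nO nN ON]]] := extension_nbhs nW.
have [O' nO' ON'] := extensionP nN.
have nO2 : nbhs (g * h * h^-1) O by rewrite mulgK.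
have [M [M' [nM /nbhs_inv nM' MM]]] := nbhs_mul nO2.
have [b Ab [O'b M'b]] := psi_dense (filterI nO' nM').
exists M => // c Ac Mc.
have -> : c x = (c * b^-1) (b x) by rewrite homeoME homeoVE homeoK.
have Acb : A (c * b^-1) by apply: AM => //; exact: AV.
rewrite -extension_psi //; apply: ON; last exact: ON'.
by rewrite psiM ?psi_V //; [exact: MM|exact: AV].
Qed.

Lemma extension_continuous g : continuous (extension g).
Proof.
move=> x W /extension_nbhs[O [N [nO nN ON]]].
by apply: filterS nN => x' Nx'; apply: ON => //; exact: nbhs_singleton.
Qed.

Lemma extensionK g : cancel (extension g) (extension g^-1).
Proof. by move=> x; rewrite -extensionM mulVg extension1. Qed.

Lemma extensionVK g : cancel (extension g^-1) (extension g).
Proof. by move=> x; rewrite -extensionM mulgV extension1. Qed.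

Definition extension_homeo (g : G) : homeo X :=
  Homeo (@extension_continuous g) (@extension_continuous g^-1)
    (@extensionK g) (@extensionVK g).

Lemma extension_homeo1 : extension_homeo 1 = 1.
Proof. by apply: homeoP => x; exact: extension1. Qed.

Lemma extension_homeoM : {morph extension_homeo : g h / g * h}.
Proof. by move=> g h; apply: homeoP => x; exact: extensionM. Qed.

Lemma extension_action : exists beta : group_hom G (homeo X),
  continuous (fun gx : G * X => beta gx.1 gx.2) /\
  forall a, A a -> beta (psi a) = a.
Proof.
pose mixin := monoid.isUMagmaMorphism.Build G (homeo X) extension_homeo
  (extension_homeo1, extension_homeoM).
pose beta : group_hom G (homeo X) := HB.pack extension_homeo mixin.
exists beta; split.
  move=> [g x] W /extension_nbhs[O [N [nO nN ON]]].
  by exists (O, N) => // -[g' x'] [Og' Nx']; exact: ON.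
by move=> a Aa; apply: homeoP => x; exact: extension_psi.
Qed.

End Extension.

Theorem theorem6p6 (R : realType) (L : groupType) (X : topologicalType)
    (act : group_hom L (homeo X)) (G : topGroupType)
    (phi : group_hom (alternating_full_groupType act) G) :
  finitely_generated L ->
  is_cantor_space X ->
  minimal_action act ->
  expansive_action R act ->
  tdlc G ->
  injective phi ->
  dense (range phi) ->
  exists beta : group_hom G (homeo X),
    continuous (fun gx : G * X => beta gx.1 gx.2) /\
    forall a : alternating_full_groupType act, beta (phi a) = \val a.
Proof.
move=> fgL /cantor_space_axioms hX minX expX tdlcG injphi densephi.
have [S [finS SA S_pairs]] := finite_cycle_system hX minX fgL expX.
(* The embedding is extended by 1 to all homeomorphisms, which avoids subtype
   coercions in the computations. *)
pose psi (g : homeo X) : G :=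
  if pselect (alternating_full_group act g) is left Ag
  then phi (SigSub (mem_set Ag)) else 1%g.
have psiE (a : alternating_full_groupType act) : psi (\val a) = phi a.
  rewrite /psi; case: pselect => [Ag|nAg].
    by congr (phi _); exact: val_inj.
  by case: nAg; case: a => g /= /set_mem.
have lift g : alternating_full_group act g ->
    exists a : alternating_full_groupType act, \val a = g.
  by move=> Ag; exists (SigSub (mem_set Ag)).
have psiM g h : alternating_full_group act g -> alternating_full_group act h ->
    psi (g * h)%g = (psi g * psi h)%g.
  by move=> /lift[a <-] /lift[b <-]; rewrite -valM !psiE gmulfM.
have psi_inj g : alternating_full_group act g -> psi g = 1%g -> g = 1%g.
  move=> /lift[a <-]; rewrite psiE => /eqP; rewrite gmulf_eq1 // => /eqP->.
  exact: gmulf1.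
have psi_dense (g : G) O : nbhs g O ->
    exists2 a, alternating_full_group act a & O (psi a).
  move=> nO.
  have [|h [/interior_subset Oh [a _ aE]]] := densephi O° _ (open_interior O).
    by exists g; apply: nbhs_singleton; exact: nbhs_interior.
  exists (\val a); last by rewrite psiE aE.
  by case: a {aE} => a /= /set_mem.
have stable :=
  clopen_stable hX minX tdlcG psiM psi_inj psi_dense finS SA S_pairs.
have [beta [cbeta betaE]] := extension_action hX
  (is_subgroup_generated _) psiM psi_dense stable.
exists beta; split=> // a; rewrite -psiE betaE //.
by case: a => a /= /set_mem.
Qed.
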